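(* Assume the standing setting below, and assume in addition that $D(A_2)\subset D(A_1^{1/2})$ and there is $c>0$ with $|A_1^{1/2}u|\le c|A_2u|$ for all $u\in D(A_2)$. Let $n\ge1$ be an integer and $0<\theta<1$. Then there is a constant $c_{n,\theta}>0$ such that for every $U_0\in(\mathcal H,D(\mathcal A^{4n}))_{\theta,2}$ the solution $U(t)=e^{t\mathcal A}U_0$ satisfies $$\|U(t)\|_{\mathcal H}^2\le\frac{c_{n,\theta}}{t^{n\theta}}\|U_0\|^2_{(\mathcal H,D(\mathcal A^{4n}))_{\theta,2}}\qquad\forall t>0.$$
   Context: Standing setting: $H$ is a real Hilbert space with inner product $\langle\cdot,\cdot\rangle$ and norm $|\cdot|$. $A_1,A_2$ are densely defined closed self-adjoint operators on $H$ with $\langle A_iu,u\rangle\ge\omega_i|u|^2$ for $u\in D(A_i)$, for some $\omega_1,\omega_2>0$; $A_i^{s}$ denote their fractional powers. $B$ is a bounded self-adjoint operator on $H$ with $\langle Bu,u\rangle\ge\beta|u|^2$ for all $u\in H$, for some $\beta>0$. $\alpha\in\mathbb R$ satisfies $0<|\alpha|<\sqrt{\omega_1\omega_2}$. Let $\mathcal H=D(A_1^{1/2})\times H\times D(A_2^{1/2})\times H$ with the inner product $(U|\widehat U)=\langle A_1^{1/2}u,A_1^{1/2}\widehat u\rangle+\langle p,\widehat p\rangle+\langle A_2^{1/2}v,A_2^{1/2}\widehat v\rangle+\langle q,\widehat q\rangle+\alpha\langle u,\widehat v\rangle+\alpha\langle v,\widehat u\rangle$ for $U=(u,p,v,q)$,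 and norm $\|U\|_{\mathcal H}=(U|U)^{1/2}$. Define $\mathcal A$ on $D(\mathcal A)=D(A_1)\times D(A_1^{1/2})\times D(A_2)\times D(A_2^{1/2})$ by $\mathcal AU=(p,-A_1u-Bp-\alpha v,q,-A_2v-\alpha u)$; it generates a $C_0$-semigroup of contractions $e^{t\mathcal A}$ on $\mathcal H$, corresponding to the system $u''+A_1u+Bu'+\alpha v=0$, $v''+A_2v+\alpha u=0$. $D(\mathcal A^k)$ carries the graph norm $\|U\|^2_{D(\mathcal A^k)}=\sum_{i=0}^k\|\mathcal A^iU\|^2_{\mathcal H}$. Real interpolation: for Banach spaces $D\hookrightarrow X$, $x\in X$, $t>0$, let $K(t,x)=\inf\{|a|_X+t|b|_D: x=a+b,\ a\in X,\ b\in D\}$; $(X,D)_{\theta,2}=\{x\in X:\int_0^\infty (t^{-\theta-1/2}K(t,x))^2dt<\infty\}$ with norm $|x|_{\theta,2}=\big(\int_0^\infty (t^{-\theta-1/2}K(t,x))^2dt\big)^{1/2}$. *)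

(* Defs.v *)
From HB Require Import structures.
From mathcomp Require Import all_boot all_order all_algebra.
From mathcomp Require Import all_classical all_reals all_analysis.
Set Implicit Arguments. Unset Strict Implicit. Unset Printing Implicit Defensive.
Import Order.TTheory GRing.Theory Num.Theory.
Import numFieldNormedType.Exports.
Local Open Scope classical_set_scope.
Local Open Scope ring_scope.

Section Ops.
Context {R : realType} {H : normedModType R}.

Definition is_inner (ip : H -> H -> R) : Prop :=
  (forall u v, ip u v = ip v u) /\
  (forall (a : R) u v w, ip (a *: u + v) w = a * ip u w + ip v w) /\
  (forall u, `|u| ^+ 2 = ip u u).

Definition lin_op (D : set H) (A : H -> H) : Prop :=
  D 0 /\ (forall (a : R) u v, D u -> D v ->
            D (a *: u + v) /\ A (a *: u + v) = a *: A u + A v).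

Definition densely_defined (D : set H) (A : H -> H) : Prop :=
  lin_op D A /\ closure D = setT.

Definition closed_op (D : set H) (A : H -> H) : Prop :=
  forall (u_ : nat -> H) (u f : H), (forall k, D (u_ k)) ->
    u_ @ \oo --> u -> (A \o u_) @ \oo --> f -> D u /\ A u = f.

Definition adj_dom (ip : H -> H -> R) (D : set H) (A : H -> H) (v : H) : Prop :=
  exists w, forall u, D u -> ip (A u) v = ip u w.

Definition self_adjoint (ip : H -> H -> R) (D : set H) (A : H -> H) : Prop :=
  densely_defined D A /\ closed_op D A /\
  (forall v, D v <-> adj_dom ip D A v) /\
  (forall u v, D u -> D v -> ip (A u) v = ip u (A v)).

Definition is_sqrt_op (ip : H -> H -> R) (D : set H) (A : H -> H)
  (E : set H) (S : H -> H) : Prop :=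
  self_adjoint ip E S /\ (forall u, E u -> 0 <= ip (S u) u) /\
  (forall u, D u <-> (E u /\ E (S u))) /\ (forall u, D u -> A u = S (S u)).

Definition bounded_sa (ip : H -> H -> R) (B : H -> H) : Prop :=
  (forall (a : R) u v, B (a *: u + v) = a *: B u + B v) /\
  (exists M : R, forall u, `|B u| <= M * `|u|) /\
  (forall u v, ip (B u) v = ip u (B v)).
End Ops.

Record St (H : Type) := MkSt { s_u : H; s_p : H; s_v : H; s_q : H }.

Section Energy.
Context {R : realType} {H : normedModType R}.

Definition st_add (U V : St H) : St H :=
  MkSt (s_u U + s_u V) (s_p U + s_p V) (s_v U + s_v V) (s_q U + s_q V).
Definition st_scale (a : R) (U : St H) : St H :=
  MkSt (a *: s_u U) (a *: s_p U) (a *: s_v U) (a *: s_q U).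

(* membership in calH = D(A1^{1/2}) x H x D(A2^{1/2}) x H *)
Definition inHH (E1 E2 : set H) (U : St H) : Prop := E1 (s_u U) /\ E2 (s_v U).

Definition hip (ip : H -> H -> R) (S1 S2 : H -> H) (alpha : R) (U V : St H) : R :=
  ip (S1 (s_u U)) (S1 (s_u V)) + ip (s_p U) (s_p V) +
  ip (S2 (s_v U)) (S2 (s_v V)) + ip (s_q U) (s_q V) +
  alpha * ip (s_u U) (s_v V) + alpha * ip (s_v U) (s_u V).

Definition hnorm ip S1 S2 alpha (U : St H) : R := Num.sqrt (hip ip S1 S2 alpha U U).

Definition DAA (D1 E1 D2 E2 : set H) (U : St H) : Prop :=
  D1 (s_u U) /\ E1 (s_p U) /\ D2 (s_v U) /\ E2 (s_q U).

Definition AA (A1 A2 B : H -> H) (alpha : R) (U : St H) : St H :=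
  MkSt (s_p U) (- A1 (s_u U) - B (s_p U) - alpha *: s_v U)
       (s_q U) (- A2 (s_v U) - alpha *: s_u U).

Fixpoint DAk (D1 E1 D2 E2 : set H) (A1 A2 B : H -> H) (alpha : R) (k : nat)
  (U : St H) : Prop :=
  match k with
  | 0 => inHH E1 E2 U
  | k'.+1 => DAA D1 E1 D2 E2 U /\ DAk D1 E1 D2 E2 A1 A2 B alpha k' (AA A1 A2 B alpha U)
  end.

Definition graph_norm ip S1 S2 (A1 A2 B : H -> H) (alpha : R) (k : nat) (U : St H) : R :=
  Num.sqrt (\sum_(i < k.+1) hnorm ip S1 S2 alpha (iter i (AA A1 A2 B alpha) U) ^+ 2).

Definition diffq_lim (N : St H -> R) (T : R -> St H -> St H) (U V : St H) : Prop :=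
  forall e : R, 0 < e -> exists d : R, 0 < d /\ forall h : R, 0 < h -> h < d ->
    N (st_add (st_scale h^-1 (st_add (T h U) (st_scale (-1) U))) (st_scale (-1) V)) < e.

Definition generates (X : set (St H)) (N : St H -> R) (Dg : set (St H))
  (G : St H -> St H) (T : R -> St H -> St H) : Prop :=
  (forall t U, 0 <= t -> X U -> X (T t U)) /\
  (forall t (a : R) U V, 0 <= t -> X U -> X V ->
     T t (st_add (st_scale a U) V) = st_add (st_scale a (T t U)) (T t V)) /\
  (forall t, 0 <= t -> exists M : R, forall U, X U -> N (T t U) <= M * N U) /\
  (forall U, X U -> T 0 U = U) /\
  (forall t s U, 0 <= t -> 0 <= s -> X U -> T (t + s) U = T t (T s U)) /\
  (forall U, X U -> forall e : R, 0 < e -> exists d : R, 0 < d /\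
     forall h, 0 <= h -> h < d -> N (st_add (T h U) (st_scale (-1) U)) < e) /\
  (forall U, Dg U -> X U /\ X (G U)) /\
  (forall U V, X U -> X V -> ((Dg U /\ G U = V) <-> diffq_lim N T U V)).

Definition Kfun (X : set (St H)) (NX : St H -> R) (Dm : set (St H))
  (ND : St H -> R) (t : R) (x : St H) : R :=
  inf [set r | exists a b, X a /\ Dm b /\ x = st_add a b /\ r = NX a + t * ND b].

Definition interp_norm2 X NX Dm ND (theta : R) (x : St H) : \bar R :=
  (\int[@lebesgue_measure R]_(t in `]0%R, +oo[%classic)
     ((t `^ (- theta - 2^-1) * Kfun X NX Dm ND t x) ^+ 2)%:E)%E.

Definition in_interp X NX Dm ND (theta : R) (x : St H) : Prop :=
  X x /\ (interp_norm2 X NX Dm ND theta x < +oo)%E.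
End Energy.

(* Main.v *)
Require Import Defs.
From HB Require Import structures.
From mathcomp Require Import all_boot all_order all_algebra.
From mathcomp Require Import all_classical all_reals all_analysis.
From mathcomp Require Import ring lra.
Import Order.TTheory GRing.Theory Num.Theory.
Import numFieldNormedType.Exports.
Local Open Scope classical_set_scope.
Local Open Scope ring_scope.

(* The energy |U|^2 only dissipates u': its derivative is -2 <B u', u'>. To recover
   v', multiply the differentiated first equation by v', which yields alpha |v'|^2, and write
   v' = - A_2^{-1} (v''' + alpha u') in the term <A_1^{1/2} u', A_1^{1/2} v'>. Two integrations by
   parts in time turn it into <A_1^{1/2} u''', A_1^{1/2} A_2^{-1} v'>, which the hypothesis
   |A_1^{1/2} u| <= c |A_2 u| bounds by c |A_1^{1/2} u'''| |v'|. The potential energy |A_1^{1/2} u'''|^2 is in turn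
   controlled by u'''', by u''''' and a small multiple of |v'|^2, so that the energy is bounded by
   |u'|^2 + ... + |u^(5)|^2 up to the derivative of a quadratic functional of U, AU, ..., A^3 U.
   Adding multiples of the energies of A^k U, k <= 4, gives a Lyapunov functional whose
   derivative is at most -|U|^2, whence t |U(t)|^2 <= C |U_0|^2 in D(A^4). Iterating on
   successive time intervals, one gets t^n |U(t)|^2 <= C |U_0|^2 in D(A^{4n}). Splitting
   U_0 = a + b then gives |U(t)| <= K(sqrt C t^{-n/2}, U_0), and K(s, x) <= C s^theta |x|_{theta,2}
   since K is nondecreasing in s.

   No integral of a vector-valued function is needed: a left continuous function with
   nonpositive right derivative is nonincreasing. The left continuity of the orbits comes from
   the uniform boundedness principle, the contractivity of the semigroup from the density of the
   domain of its generator, itself a consequence of the projection theorem. *)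

(** * Projection in complete semi-inner product spaces *)

Section SemiInner.
Context {R : realType} {V : lmodType R}.

Definition lsubspace (X : set V) : Prop :=
  X 0 /\ forall (a : R) u v, X u -> X v -> X (a *: u + v).

(** One notion serves [H], graph norms and the energy space. The form is constrained only on [X],
    since operators are total functions that carry meaning on their domains. *)
Record semi_inner (X : set V) (b : V -> V -> R) : Prop := SemiInner {
  si_sub : lsubspace X;
  si_sym : forall u v, X u -> X v -> b u v = b v u;
  si_lin : forall a u v w, X u -> X v -> X w ->
             b (a *: u + v) w = a * b u w + b v w;
  si_ge0 : forall u, X u -> 0 <= b u u }.

Definition snorm (b : V -> V -> R) (u : V) : R := Num.sqrt (b u u).

Definition scomplete (X : set V) (b : V -> V -> R) : Prop :=
  forall u_ : nat -> V, (forall n, X (u_ n)) ->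
    (forall e : R, 0 < e -> exists N0, forall m n, (N0 <= m)%N -> (N0 <= n)%N ->
       snorm b (u_ m - u_ n) < e) ->
    exists2 u, X u & forall e : R, 0 < e -> exists N0, forall n, (N0 <= n)%N ->
       snorm b (u_ n - u) < e.

Section Subspace.
Variables (X : set V) (sX : lsubspace X).

Lemma lsub0 : X 0. Proof. by case: sX. Qed.
Lemma lsubL a u v : X u -> X v -> X (a *: u + v). Proof. by case: sX => _; apply. Qed.
Lemma lsubD u v : X u -> X v -> X (u + v).
Proof. by move=> Xu Xv; rewrite -[u]scale1r; apply: lsubL. Qed.
Lemma lsubZ a u : X u -> X (a *: u).
Proof. by move=> Xu; rewrite -[_ *: _]addr0; apply: lsubL => //; apply: lsub0. Qed.
Lemma lsubN u : X u -> X (- u).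
Proof. by move=> Xu; rewrite -scaleN1r; apply: lsubZ. Qed.
Lemma lsubB u v : X u -> X v -> X (u - v).
Proof. by move=> Xu Xv; apply: lsubD => //; apply: lsubN. Qed.
End Subspace.

Section Theory.
Variables (X : set V) (b : V -> V -> R) (hb : semi_inner X b).
Let sX := si_sub _ _ hb.
Local Notation N := (snorm b).

Lemma si0l w : X w -> b 0 w = 0.
Proof.
move=> Xw; have := si_lin _ _ hb 1 _ _ _ (lsub0 _ sX) (lsub0 _ sX) Xw.
rewrite scaler0 addr0; lra.
Qed.
Lemma siDl u v w : X u -> X v -> X w -> b (u + v) w = b u w + b v w.
Proof.
by move=> Xu Xv Xw; rewrite -{1}[u]scale1r (si_lin _ _ hb) // mul1r.
Qed.
Lemma siZl a u w : X u -> X w -> b (a *: u) w = a * b u w.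
Proof.
move=> Xu Xw; rewrite -[_ *: _]addr0 (si_lin _ _ hb) //; last exact: lsub0.
by rewrite si0l // addr0.
Qed.
Lemma siBl u v w : X u -> X v -> X w -> b (u - v) w = b u w - b v w.
Proof.
move=> Xu Xv Xw; rewrite siDl //; last exact: lsubN.
by rewrite -scaleN1r siZl // mulN1r.
Qed.
Lemma siDr u v w : X u -> X v -> X w -> b w (u + v) = b w u + b w v.
Proof.
move=> Xu Xv Xw; rewrite (si_sym _ _ hb) ?siDl //; last exact: lsubD.
by congr (_ + _); apply: (si_sym _ _ hb).
Qed.
Lemma siZr a u w : X u -> X w -> b w (a *: u) = a * b w u.
Proof.
move=> Xu Xw; rewrite (si_sym _ _ hb) ?siZl //; last exact: lsubZ.
by congr (_ * _); apply: (si_sym _ _ hb).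
Qed.

Lemma snorm_ge0 u : 0 <= N u. Proof. exact: sqrtr_ge0. Qed.
Lemma sqr_snorm u : X u -> N u ^+ 2 = b u u.
Proof. by move=> Xu; rewrite sqr_sqrtr // (si_ge0 _ _ hb). Qed.
Lemma snormZ a u : X u -> N (a *: u) = `|a| * N u.
Proof.
move=> Xu; rewrite /snorm siZl ?siZr //; last exact: lsubZ.
by rewrite mulrA -expr2 sqrtrM ?sqr_ge0 // sqrtr_sqr.
Qed.
Lemma snormN u : X u -> N (- u) = N u.
Proof. by move=> Xu; rewrite -scaleN1r snormZ // normrN1 mul1r. Qed.
Lemma snorm0 : N 0 = 0.
Proof. by rewrite /snorm si0l ?sqrtr0 //; exact: lsub0. Qed.
Lemma snormBC u v : X u -> X v -> N (u - v) = N (v - u).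
Proof. by move=> Xu Xv; rewrite -opprB snormN //; exact: lsubB. Qed.

Lemma si_expand a u v : X u -> X v ->
  b (a *: u + v) (a *: u + v) = a ^+ 2 * b u u + 2 * a * b u v + b v v.
Proof.
move=> Xu Xv; have Xw := lsubL _ sX a _ _ Xu Xv.
have Xz := lsubZ _ sX a _ Xu.
rewrite siDl // !siDr // !siZl // siZr // siZr // (si_sym _ _ hb v u) //; ring.
Qed.

Lemma cauchy_schwarz u v : X u -> X v -> `|b u v| <= N u * N v.
Proof.
move=> Xu Xv.
have pos a : 0 <= a ^+ 2 * b u u + 2 * a * b u v + b v v.
  by rewrite -si_expand //; apply: (si_ge0 _ _ hb); apply: lsubL.
have ge0u := si_ge0 _ _ hb _ Xu; have ge0v := si_ge0 _ _ hb _ Xv.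
suff H : b u v ^+ 2 <= b u u * b v v.
  rewrite /snorm -sqrtrM // -sqrtr_sqr ler_sqrt //; exact: mulr_ge0.
have [u0|un0] := eqVneq (b u u) 0.
  rewrite u0 mul0r; have [->|bn0] := eqVneq (b u v) 0; first by rewrite expr0n.
  (* For isotropic [u] the quadratic is affine in [a], and this [a] gives it the value -1. *)
  have := pos (- (b v v + 1) / (2 * b u v)); rewrite u0 mulr0 add0r.
  have -> : 2 * (- (b v v + 1) / (2 * b u v)) * b u v = - (b v v + 1) by field.
  lra.
have up : 0 < b u u by rewrite lt_def un0.
have := pos (- b u v / b u u).
have -> : (- b u v / b u u) ^+ 2 * b u u + 2 * (- b u v / b u u) * b u v + b v v
  = (b u u * b v v - b u v ^+ 2) / b u u by field.
by rewrite pmulr_lge0 ?invr_gt0 // subr_ge0.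
Qed.

Lemma ler_snormD u v : X u -> X v -> N (u + v) <= N u + N v.
Proof.
move=> Xu Xv; rewrite -ler_sqr ?nnegrE ?addr_ge0 ?snorm_ge0 //.
rewrite sqr_snorm; last exact: lsubD.
have := si_expand 1 _ _ Xu Xv; rewrite scale1r => ->.
rewrite sqrrD !sqr_snorm // expr1n mul1r mulr1 mulr2n.
have := cauchy_schwarz u v Xu Xv; rewrite ler_norml => /andP[_]; lra.
Qed.
Lemma ler_snorm_dist u v w : X u -> X v -> X w ->
  N (u - w) <= N (u - v) + N (v - w).
Proof.
move=> Xu Xv Xw; rewrite -(subrKA v u (- w)).
by apply: ler_snormD; apply: lsubB.
Qed.

Lemma parallelogram u v : X u -> X v ->
  N (u - v) ^+ 2 + N (u + v) ^+ 2 = 2 * N u ^+ 2 + 2 * N v ^+ 2.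
Proof.
move=> Xu Xv; rewrite !sqr_snorm //; [|exact: lsubD|exact: lsubB].
have := si_expand 1 _ _ Xu Xv; rewrite scale1r => ->.
have := si_expand (-1) _ _ Xv Xu; rewrite scaleN1r addrC => ->.
rewrite (si_sym _ _ hb v u) //; lra.
Qed.

(* Projecting [x] on the closure of [M] leaves a residue orthogonal to [M]. *)
Lemma dense_of_orthogonal (M : set V) : scomplete X b -> lsubspace M -> M `<=` X ->
  (forall z, X z -> (forall m, M m -> b z m = 0) -> b z z = 0) ->
  forall x, X x -> forall e : R, 0 < e -> exists2 m, M m & N (x - m) < e.
Proof.
move=> cX sM MX orth x Xx.
pose D := [set N (x - m) | m in M].
have D0 : D !=set0 by exists (N (x - 0)), 0 => //; apply: lsub0.
have Dlb : has_lbound D by exists 0 => _ [m _ <-]; apply: snorm_ge0.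
pose d := inf D.
have dle m : M m -> d <= N (x - m) by move=> Mm; apply: ge_inf => //; exists m.
have d0 : 0 <= d by apply: lb_le_inf => // _ [m _ <-]; apply: snorm_ge0.
have Dclose e : 0 < e -> exists2 m, M m & N (x - m) < d + e.
  move=> e0; have [_ [m Mm <-] lt] := inf_adherent e0 (conj D0 Dlb).
  by exists m.
suff d_eq0 : d = 0 by move=> e /Dclose; rewrite d_eq0 add0r.
have /choice [m_ m_P] : forall n, exists m, M m /\ N (x - m) < d + n.+1%:R^-1.
  move=> n; have [|m ? ?] := Dclose n.+1%:R^-1; first by rewrite invr_gt0.
  by exists m.
have Mm n : M (m_ n) by case: (m_P n).
have Xm n : X (m_ n) by apply: MX.
have inv_small e : 0 < e -> exists N0 : nat, forall n, (N0 <= n)%N -> n.+1%:R^-1 < e :> R.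
  move=> e0; exists (Num.truncn e^-1) => n len.
  rewrite invf_plt ?posrE ?ltr0n // (lt_le_trans (truncnS_gt _)) // ler_nat.
  by rewrite ltnS.
(* The midpoint of [m_ p] and [m_ q] lies in [M], at distance at least [d] from [x]; the
   parallelogram law then leaves 4 (d + r)^2 - 4 d^2. *)
have est p q r : N (x - m_ p) < d + r -> N (x - m_ q) < d + r -> 0 < r ->
    N (m_ p - m_ q) ^+ 2 <= 8 * d * r + 4 * r ^+ 2.
  move=> hp hq r0.
  have XA := lsubB _ sX _ _ Xx (Xm p); have XB := lsubB _ sX _ _ Xx (Xm q).
  have := parallelogram _ _ XA XB.
  have -> : x - m_ p - (x - m_ q) = m_ q - m_ p.
    by rewrite opprB addrC addrA subrK.
  rewrite (snormBC (m_ q)) //.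
  have h : 2 * d <= N (x - m_ p + (x - m_ q)).
    have /dle : M (2^-1 *: (m_ p + m_ q)) by apply: lsubZ => //; apply: lsubD.
    have -> : x - m_ p + (x - m_ q) = 2 *: (x - 2^-1 *: (m_ p + m_ q)).
      rewrite scalerBr scalerA divff ?pnatr_eq0 // scale1r scaler_nat mulr2n.
      by rewrite addrACA opprD.
    rewrite snormZ; last by apply: lsubB => //; apply: lsubZ => //; apply: lsubD.
    by rewrite ger0_norm //; lra.
  have h2 : (2 * d) ^+ 2 <= N (x - m_ p + (x - m_ q)) ^+ 2.
    by rewrite ler_sqr ?nnegrE ?snorm_ge0 //; lra.
  have h3 : N (x - m_ p) ^+ 2 <= (d + r) ^+ 2.
    by rewrite ler_sqr ?nnegrE ?snorm_ge0 //; lra.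
  have h4 : N (x - m_ q) ^+ 2 <= (d + r) ^+ 2.
    by rewrite ler_sqr ?nnegrE ?snorm_ge0 //; lra.
  lra.
have cau e : 0 < e -> exists N0, forall m n, (N0 <= m)%N -> (N0 <= n)%N ->
       N (m_ m - m_ n) < e.
  move=> e0.
  (* Since r <= 1, the estimate is at most r (8 d + 4), which is below e^2. *)
  pose r := Num.min 1 (e ^+ 2 / (8 * d + 5)).
  have e2 : 0 < e ^+ 2 by apply: exprn_gt0.
  have dd : 0 < 8 * d + 5 by lra.
  have r0 : 0 < r by rewrite lt_min ltr01 divr_gt0.
  have [N0 hN0] := inv_small _ r0; exists N0 => p q lep leq.
  have close n : (N0 <= n)%N -> N (x - m_ n) < d + r.
    move=> /hN0 h; have [_ h1] := m_P n; apply: lt_trans h1 _.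
    by rewrite ltrD2l.
  have := est _ _ _ (close _ lep) (close _ leq) r0.
  have r1 : r <= 1 by rewrite ge_min lexx.
  have r2 : r * (8 * d + 5) <= e ^+ 2 by rewrite -ler_pdivlMr // ge_min lexx orbT.
  move=> h; rewrite -ltr_sqr ?nnegrE ?snorm_ge0 //; last lra.
  nra.
have [w Xw wlim] := cX _ Xm cau.
have Xz := lsubB _ sX _ _ Xx Xw.
have zd : N (x - w) <= d.
  apply/ler_addgt0Pr => e e0.
  have e2 : 0 < e / 2 by lra.
  have [N1 h1] := wlim _ e2; have [N2 h2] := inv_small _ e2.
  pose n := maxn N1 N2.
  have := h1 n (leq_maxl _ _); have := h2 n (leq_maxr _ _).
  have [_] := m_P n; have := ler_snorm_dist _ _ _ Xx (Xm n) Xw.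
  by move: (n.+1%:R^-1) => i; lra.
have wM e : 0 < e -> exists2 m, M m & N (w - m) < e.
  move=> /wlim [N0 /(_ N0 (leqnn _)) h]; exists (m_ N0) => //.
  by rewrite snormBC.
have zmin m : M m -> d <= N (x - w - m).
  move=> Mm'; apply/ler_addgt0Pr => e /wM [m' Mm2 h].
  have := dle _ (lsubD _ sM _ _ Mm2 Mm').
  have -> : x - (m' + m) = (x - w - m) + (w - m').
    by rewrite opprD addrA [x - w - m]addrAC subrKA addrAC.
  have := ler_snormD _ _ (lsubB _ sX _ _ Xz (MX _ Mm')) (lsubB _ sX _ _ Xw (MX _ Mm2)).
  lra.
suff z0 : b (x - w) (x - w) = 0.
  apply/eqP; rewrite eq_le d0 andbT.
  by have := zmin 0 (lsub0 _ sM); rewrite subr0 /snorm z0 sqrtr0.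
apply: orth => // m Mm'.
have Xm' := MX _ Mm'.
(* First variation: moving the residue [x - w] along [M] cannot bring its norm below [d]. *)
have quad a : 0 <= a ^+ 2 * b m m + 2 * a * b m (x - w).
  have Mam := lsubZ _ sM (- a) _ Mm'.
  have /zmin := Mam; rewrite scaleNr opprK addrC => h.
  have : d ^+ 2 <= N (a *: m + (x - w)) ^+ 2.
    by rewrite ler_sqr ?nnegrE ?snorm_ge0.
  rewrite sqr_snorm ?si_expand //; last exact: lsubL.
  have : N (x - w) ^+ 2 <= d ^+ 2 by rewrite ler_sqr ?nnegrE ?snorm_ge0.
  by rewrite sqr_snorm //; lra.
rewrite (si_sym _ _ hb) //.
have ge0m := si_ge0 _ _ hb _ Xm'.
set B := b m (x - w) in quad *; set A := b m m in quad ge0m *.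
have A1 : 0 < A + 1 by lra.
(* The minimiser with A + 1 in place of A, which stays positive when [m] is isotropic. *)
have := quad (- B / (A + 1)).
have -> : (- B / (A + 1)) ^+ 2 * A + 2 * (- B / (A + 1)) * B
  = - (B ^+ 2 * (A + 2) / (A + 1) ^+ 2) by field; lra.
rewrite oppr_ge0 ler_pdivrMr ?exprn_gt0 // mul0r pmulr_lle0; last lra.
by move=> h; apply/eqP; rewrite -sqrf_eq0 eq_le h sqr_ge0.
Qed.

End Theory.
End SemiInner.

(** * Functions with a right derivative *)

Section RightDerivative.
Context {R : realType}.
Implicit Types f g k l : R -> R.

Lemma cvg_right0P f (a : R) : f h @[h --> 0^'+] --> a <->
  (forall e : R, 0 < e -> exists2 d : R, 0 < d & forall h : R, 0 < h -> h < d -> `|f h - a| < e).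
Proof.
split.
  move=> /cvgrPdist_lt cf e e0; have [d /= d0 hd] := cf _ e0.
  exists d => // h h0 hd'; rewrite distrC; apply: hd => //=.
  by rewrite sub0r normrN gtr0_norm.
move=> hf; apply/cvgrPdist_lt => e /hf [d d0 hd]; near=> h; rewrite distrC; apply: hd.
  by near: h; exact: nbhs_right_gt.
by near: h; exact: nbhs_right_lt.
Unshelve. all: by end_near. Qed.

(* Only right derivatives of orbits are available; left continuity is what makes their sign
   control monotonicity. *)
Definition rdiff f l : Prop := forall t : R, 0 <= t ->
  (h^-1 * (f (t + h) - f t) @[h --> 0^'+] --> l t) /\
  (0 < t -> f (t - h) @[h --> 0^'+] --> f t).

Lemma rdiffD f g k l : rdiff f k -> rdiff g l ->
  rdiff (fun t => f t + g t) (fun t => k t + l t).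
Proof.
move=> df dg t t0; have [f1 f2] := df t t0; have [g1 g2] := dg t t0; split.
  rewrite (_ : (fun h => _) = (fun h => h^-1 * (f (t + h) - f t)) \+
             (fun h => h^-1 * (g (t + h) - g t))); first exact: cvgD.
  by apply/funext => h /=; ring.
by move=> tp; apply: cvgD; [exact: f2|exact: g2].
Qed.

Lemma rdiffZ a f k : rdiff f k -> rdiff (fun t => a * f t) (fun t => a * k t).
Proof.
move=> df t t0; have [f1 f2] := df t t0; split.
  rewrite (_ : (fun h => _) = (fun h => a * (h^-1 * (f (t + h) - f t)))).
    by apply: cvgM => //; exact: cvg_cst.
  by apply/funext => h /=; ring.
by move=> tp; apply: cvgM; [exact: cvg_cst|exact: f2].
Qed.

Lemma rdiffM_linear a : rdiff (fun t => t * a) (fun=> a).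
Proof.
move=> t t0; split.
  apply/cvg_right0P => e e0; exists 1 => // h h0 _.
  suff -> : h^-1 * ((t + h) * a - t * a) - a = 0 by rewrite normr0.
  by field; rewrite gt_eqF.
move=> _; apply/cvg_right0P => e e0.
have a0 : 0 < `|a| + 1 by rewrite ltr_wpDl.
exists (e / (`|a| + 1)); first exact: divr_gt0.
move=> h h0; rewrite ltr_pdivlMr // => he.
rewrite (_ : _ - _ = - (h * a)); last ring.
rewrite normrN normrM gtr0_norm //; nra.
Qed.

(** With a slack slope [e], let [s] be the supremum of the points up to which f x <= f 0 + e x. Left
    continuity gives the bound at [s] itself, and the right derivative, being less than [e], carries
    it beyond [s] unless s = t. *)
Lemma rdiff_decr f l (t : R) : rdiff f l -> 0 <= t ->
  (forall s : R, 0 <= s -> s < t -> l s <= 0) -> f t <= f 0.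
Proof.
move=> df t0 l0; apply/ler_addgt0Pr => /= e0 e0p.
(* Chosen so that e t <= e0 without dividing by zero at t = 0. *)
pose e := e0 / (t + 1).
have ep : 0 < e by rewrite divr_gt0 // ltr_wpDl.
have : f t <= f 0 + e * t; last first.
  have : e * (t + 1) = e0 by rewrite /e divfK // gt_eqF // ltr_wpDl.
  nra.
pose D := [set s : R | 0 <= s <= t /\ forall x : R, 0 <= x <= s -> f x <= f 0 + e * x].
have D0 : D 0.
  split; first by rewrite lexx.
  by move=> x; rewrite -eq_le => /eqP <-; rewrite mulr0 addr0.
have Dub : has_ubound D by exists t => s [/andP[]].
have Dsup : has_sup D by split; [exists 0|].
set s := sup D.
have s0 : 0 <= s by exact: ub_le_sup.
have st : s <= t by apply: ge_sup; [exists 0|move=> x [/andP[]]].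
have below x : 0 <= x -> x < s -> f x <= f 0 + e * x.
  move=> x0 xs; have [|y [_ hy] /= xy] := @sup_adherent _ _ (s - x) _ Dsup.
    by rewrite subr_gt0.
  by apply: hy; rewrite x0 ltW //; move: xy; rewrite opprB addrC subrK.
have [df1 df2] := df s s0.
have fs : f s <= f 0 + e * s.
  have [sp|] := ltrP 0 s; last first.
    move=> s1; have -> : s = 0 by apply/eqP; rewrite eq_le s1 s0.
    by rewrite mulr0 addr0.
  apply/ler_addgt0Pr => e1 e1p.
  have [d d0 hd] := (cvg_right0P _ _).1 (df2 sp) _ e1p.
  pose h := Num.min (d / 2) s.
  have hp : 0 < h by rewrite lt_min divr_gt0.
  have hle : h <= s by rewrite ge_min lexx orbT.
  have hled : h <= d / 2 by rewrite ge_min lexx.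
  have h1 : f (s - h) <= f 0 + e * (s - h) by apply: below; lra.
  have := hd h hp; rewrite ltr_norml => /(_ _)/andP[]; first lra.
  by nra.
have [->|nst] := eqVneq t s; first exact: fs.
have {nst}st : s < t by rewrite lt_neqAle eq_sym nst.
have [d d0 hd] := (cvg_right0P _ _).1 df1 _ ep.
pose h := Num.min (d / 2) (t - s).
have hp : 0 < h by rewrite lt_min divr_gt0 // subr_gt0.
have hle : h <= t - s by rewrite ge_min lexx orbT.
have hled : h <= d / 2 by rewrite ge_min lexx.
suff : D (s + h) by move=> /(ub_le_sup Dub); rewrite -/s; lra.
split; first by apply/andP; split; lra.
move=> x /andP[x0 xsh].
have [xs|] := ltrP x s; first exact: below.
rewrite le_eqVlt => /orP[/eqP <-//|sx].
have := hd (x - s); rewrite subr_gt0 => /(_ sx); rewrite [s + _]addrC subrK.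
rewrite ltr_norml => /(_ _)/andP[]; first lra.
move=> _; rewrite ltrBlDr => h1.
have h2 : (x - s)^-1 * (f x - f s) < e by have := l0 s s0 st; lra.
have xs0 : 0 < x - s by lra.
have : f x - f s < (x - s) * e by rewrite -ltr_pdivrMl.
nra.
Qed.

Lemma invS_small (e : R) : 0 < e ->
  exists N0 : nat, forall n, (N0 <= n)%N -> n.+1%:R^-1 < e.
Proof.
move=> e0; exists (Num.truncn e^-1) => n len.
rewrite invf_plt ?posrE ?ltr0n // (lt_le_trans (truncnS_gt _)) // ler_nat.
by rewrite ltnS.
Qed.
End RightDerivative.

(** * Uniform boundedness *)

Section UniformBound.
Context {R : realType} {V : lmodType R}.
Variables (X : set V) (b : V -> V -> R) (hb : semi_inner X b).
Let sX := si_sub _ _ hb.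
Local Notation N := (snorm b).

Definition lin_on (X : set V) (L : V -> V) : Prop := (forall u, X u -> X (L u)) /\
  forall a u v, X u -> X v -> L (a *: u + v) = a *: L u + L v.

Section LinOn.
Variables (L : V -> V) (hL : lin_on X L).
Lemma lin_onX u : X u -> X (L u). Proof. by case: hL => + _; apply. Qed.
Lemma lin_on0 : L 0 = 0.
Proof.
have := hL.2 1 0 0 (lsub0 _ sX) (lsub0 _ sX).
by rewrite !scale1r addr0 => /eqP; rewrite -subr_eq0 opprD addrA subrr sub0r oppr_eq0 => /eqP.
Qed.
Lemma lin_onZ a u : X u -> L (a *: u) = a *: L u.
Proof.
by move=> Xu; rewrite -[_ *: u]addr0 hL.2 ?lin_on0 ?addr0 //; exact: lsub0.
Qed.
Lemma lin_onD u v : X u -> X v -> L (u + v) = L u + L v.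
Proof. by move=> Xu Xv; rewrite -[u]scale1r hL.2 // !scale1r. Qed.
Lemma lin_onB u v : X u -> X v -> L (u - v) = L u - L v.
Proof.
move=> Xu Xv; rewrite lin_onD //; last exact: lsubN.
by rewrite -[- v]scaleN1r lin_onZ // scaleN1r.
Qed.

(** The infimum [a] of the admissible bounds is itself a bound, while 2/3 a is not, so some
    normalised vector almost attains it. As [c] is not a bound, every admissible bound is at least
    [c]. *)
Lemma norming_vector (M c : R) : (forall u, X u -> N (L u) <= M * N u) -> 0 < c ->
  ~ (forall u, X u -> N (L u) <= c * N u) ->
  exists a w, [/\ c <= a, X w, N w <= 1, (forall u, X u -> N (L u) <= a * N u) &
                  2 / 3 * a <= N (L w)].
Proof.
move=> hM c0 nc.
pose D := [set m : R | 0 <= m /\ forall u, X u -> N (L u) <= m * N u].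
have DM : D `|M|.
  split=> // u Xu; apply: le_trans (hM u Xu) _.
  by rewrite ler_wpM2r ?snorm_ge0 // ler_norm.
have Dlb : has_lbound D by exists 0 => m [].
have Dinf : has_inf D by split; [exists (`|M|)|].
pose a := inf D.
have ca : c <= a.
  apply: lb_le_inf; first by exists (`|M|).
  move=> m [m0 hm]; rewrite leNgt; apply/negP => mc; apply: nc => u Xu.
  by apply: le_trans (hm u Xu) _; rewrite ler_wpM2r ?snorm_ge0 // ltW.
have ab u : X u -> N (L u) <= a * N u.
  move=> Xu; apply/ler_addgt0Pr => e e0.
  have Nu := snorm_ge0 b u.
  have e1 : 0 < e / (N u + 1) by rewrite divr_gt0 // ltr_wpDl.
  have [m [m0 hm] ma] := inf_adherent e1 Dinf.
  have := hm u Xu.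
  have : e / (N u + 1) * (N u + 1) = e by rewrite divfK // gt_eqF // ltr_wpDl.
  rewrite -/a in ma; nra.
have nD : ~ D (2 / 3 * a).
  by move=> /(ge_inf Dlb); rewrite -/a; lra.
have [u Xu hu] : exists2 u, X u & 2 / 3 * a * N u < N (L u).
  apply: contrapT => H; apply: nD; split; first lra.
  by move=> u Xu; rewrite leNgt; apply/negP => lt; apply: H; exists u.
have Nu : 0 < N u.
  rewrite lt_def snorm_ge0 andbT; apply/eqP => Nu0.
  by have := hM u Xu; move: hu; rewrite Nu0 !mulr0; lra.
exists a, ((N u)^-1 *: u); split => //.
- exact: lsubZ.
- by rewrite (snormZ _ _ hb) // gtr0_norm ?invr_gt0 // mulVf // gt_eqF.
- rewrite lin_onZ // (snormZ _ _ hb) //; last exact: lin_onX.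
  by rewrite gtr0_norm ?invr_gt0 // ler_pdivlMl // mulrC ltW.
Qed.
End LinOn.

(* Sokal's elementary proof of the uniform boundedness principle. *)
Lemma gliding_hump (L : nat -> V -> V) (a : nat -> R) (w : nat -> V) :
  scomplete X b -> (forall n, lin_on X (L n)) -> (forall n, 0 <= a n) ->
  (forall n u, X u -> N (L n u) <= a n * N u) -> (forall n, X (w n)) ->
  (forall n, N (w n) <= 1) -> (forall n, 2 / 3 * a n <= N (L n (w n))) ->
  exists2 x, X x & forall n, a n * 3^-1 ^+ n / 6 <= N (L n x).
Proof.
move=> cX hL a0 La Xw w1 wa.
pose r n : R := 3^-1 ^+ n.
have r0 n : 0 < r n by rewrite exprn_gt0 // invr_gt0.
have rS n : r n.+1 = r n / 3 by rewrite /r exprS mulrC.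
(* The sign makes the image of the new point under [L n] at least as large as that of [r n *: w n]:
   the images for the two signs differ by twice that vector. *)
pose step n x := if N (L n (r n *: w n)) <= N (L n (r n *: w n + x)) then
  r n *: w n + x else - (r n) *: w n + x.
pose x_ := fix x_ n := if n is n'.+1 then step n' (x_ n') else 0.
have Xx n : X (x_ n).
  elim: n => [|n IH] /=; first exact: lsub0.
  by rewrite /step; case: ifP => _; apply: lsubL.
have dx n : N (x_ n.+1 - x_ n) <= r n.
  have rw : `|r n| * N (w n) <= r n.
    by rewrite gtr0_norm // ler_piMr // ltW.
  rewrite /= /step; case: ifP => _; rewrite addrK (snormZ _ _ hb) //.
  by rewrite normrN.
have big n : 2 / 3 * a n * r n <= N (L n (x_ n.+1)).
  have Xr := lsubZ _ sX (r n) _ (Xw n).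
  have Xl := lin_onX _ (hL n).
  apply: (@le_trans _ _ (N (L n (r n *: w n)))).
    rewrite (lin_onZ _ (hL n)) // (snormZ _ _ hb) ?gtr0_norm //; last exact: Xl.
    by rewrite mulrC ler_pM2l.
  rewrite /= /step; case: ifPn => //; rewrite -ltNge.
  rewrite scaleNr (lin_onD _ (hL n)) // (lin_onD _ (hL n)) //; last exact: lsubN.
  rewrite -scaleNr (lin_onZ _ (hL n) (- _)) // scaleNr -(lin_onZ _ (hL n)) //.
  set p := L n (r n *: w n); set q := L n (x_ n) => lt.
  have Xp : X p by exact: Xl. have Xq : X q by exact: Xl.
  have XA := lsubD _ sX _ _ Xp Xq.
  have XB := lsubB _ sX _ _ Xp Xq.
  have := ler_snormD _ _ hb _ _ XA XB.
  have -> : p + q + (p - q) = 2 *: p.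
    by rewrite addrACA subrr addr0 scaler_nat mulr2n.
  rewrite (snormZ _ _ hb) // ger0_norm // [- p + q]addrC (snormBC _ _ hb q) //; lra.
(* Geometric sum of the step lengths from [r n] to [r (n + k - 1)]. *)
have dist n k : N (x_ (n + k)%N - x_ n) <= 3 / 2 * (r n - r (n + k)%N).
  elim: k => [|k IH]; first by rewrite addn0 subrr (snorm0 _ _ hb) subrr mulr0.
  have := ler_snorm_dist _ _ hb _ _ _ (Xx (n + k.+1)%N) (Xx (n + k)%N) (Xx n).
  rewrite addnS; have := dx (n + k)%N; rewrite rS; lra.
have dist' n m : (n <= m)%N -> N (x_ m - x_ n) <= 3 / 2 * r n.
  by move=> /subnKC <-; have := dist n (m - n)%N; have := r0 (n + (m - n))%N; lra.
have rsmall (e : R) : 0 < e -> exists n, r n < e.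
  move=> /invS_small [n hn]; exists n; apply: le_lt_trans (hn n (leqnn _)).
  rewrite /r exprVn lef_pV2 ?posrE ?exprn_gt0 ?ltr0n //.
  by rewrite -natrX ler_nat ltn_expl.
have cau (e : R) : 0 < e -> exists N0, forall m n, (N0 <= m)%N -> (N0 <= n)%N ->
       N (x_ m - x_ n) < e.
  move=> e0; have [|n0 hn0] := rsmall (e / 3); first by lra.
  exists n0 => m n hm hn.
  have := ler_snorm_dist _ _ hb _ _ _ (Xx m) (Xx n0) (Xx n).
  rewrite (snormBC _ _ hb (x_ n0)) //.
  have := dist' _ _ hm; have := dist' _ _ hn; lra.
have [x Xx' lim] := cX _ Xx cau.
exists x => // n.
(* The tail costs at most [a n * r n / 2] of the 2/3 [a n * r n] gained at step [n]; a sixth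
   remains. *)
have close : N (x_ n.+1 - x) <= r n / 2.
  apply/ler_addgt0Pr => e /lim [N0 hN0].
  pose m := maxn N0 n.+1.
  have := hN0 m (leq_maxl _ _); have := dist' n.+1 m (leq_maxr _ _).
  have := ler_snorm_dist _ _ hb _ _ _ (Xx n.+1) (Xx m) Xx'.
  rewrite (snormBC _ _ hb (x_ n.+1) (x_ m)) // rS; lra.
have Xd := lsubB _ sX _ _ (Xx n.+1) Xx'.
have h1 := La n _ Xd; rewrite (lin_onB _ (hL n)) // in h1.
have Xl := lin_onX _ (hL n).
have h2 := ler_snormD _ _ hb _ _ (lsubB _ sX _ _ (Xl _ (Xx n.+1)) (Xl _ Xx')) (Xl _ Xx').
rewrite subrK in h2.
have h3 := big n; have h4 := a0 n.
have h5 : a n * N (x_ n.+1 - x) <= a n * (r n / 2) by exact: ler_wpM2l.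
rewrite -/(r n); lra.
Qed.
End UniformBound.

(** * Strongly continuous semigroups *)

Section Semigroup.
Context {R : realType} {V : lmodType R}.
Variables (X : set V) (b : V -> V -> R) (hb : semi_inner X b).
Let sX := si_sub _ _ hb.
Local Notation N := (snorm b).

Definition ncvg (a : R -> V) (a0 : V) : Prop := N (a h - a0) @[h --> 0^'+] --> (0 : R).

(** Bounded bilinear forms for the seminorm of [b]; each term of the Lyapunov functional is a
    multiple of one, evaluated on two orbits. *)
Record bform (beta : V -> V -> R) : Prop := BForm {
  bf_l : forall a u v w, X u -> X v -> X w ->
    beta (a *: u + v) w = a * beta u w + beta v w;
  bf_r : forall a u v w, X u -> X v -> X w ->
    beta w (a *: u + v) = a * beta w u + beta w v;
  bf_bnd : exists2 C : R, 0 <= C & forall u v, X u -> X v ->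
    `|beta u v| <= C * (N u * N v) }.

Lemma bform_inner : bform b.
Proof.
split.
- exact: si_lin.
- move=> a u v w Xu Xv Xw; rewrite (siDr _ _ hb) ?(siZr _ _ hb) //.
  exact: lsubZ.
- by exists 1 => // u v Xu Xv; rewrite mul1r; exact: (cauchy_schwarz _ _ hb).
Qed.

Lemma bf_Bl beta u v w : bform beta -> X u -> X v -> X w ->
  beta (u - v) w = beta u w - beta v w.
Proof.
by move=> hf Xu Xv Xw; rewrite addrC -scaleN1r (bf_l _ hf) // mulN1r addrC.
Qed.
Lemma bf_Br beta u v w : bform beta -> X u -> X v -> X w ->
  beta w (u - v) = beta w u - beta w v.
Proof.
by move=> hf Xu Xv Xw; rewrite addrC -scaleN1r (bf_r _ hf) // mulN1r addrC.
Qed.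
Lemma bf_Zl beta a u w : bform beta -> X u -> X w -> beta (a *: u) w = a * beta u w.
Proof.
move=> hf Xu Xw; have X0 := lsub0 _ sX.
have h0 : beta 0 w = 0 by have := bf_Bl _ _ _ _ hf Xu Xu Xw; rewrite !subrr.
by rewrite -[_ *: _]addr0 (bf_l _ hf) // h0 addr0.
Qed.
Lemma bf_Zr beta a u w : bform beta -> X u -> X w -> beta w (a *: u) = a * beta w u.
Proof.
move=> hf Xu Xw; have X0 := lsub0 _ sX.
have h0 : beta w 0 = 0 by have := bf_Br _ _ _ _ hf Xu Xu Xw; rewrite !subrr.
by rewrite -[_ *: _]addr0 (bf_r _ hf) // h0 addr0.
Qed.

Lemma bform_bound beta : bform beta -> exists2 C : R, 0 <= C & forall u v, X u -> X v ->
  `|beta u v| <= C * (N u ^+ 2 + N v ^+ 2).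
Proof.
case=> _ _ [C C0 hC]; exists C => // u v Xu Xv; apply: le_trans (hC u v Xu Xv) _.
apply: ler_wpM2l => //; have := sqr_ge0 (N u - N v).
have := sqr_ge0 (N u); have := sqr_ge0 (N v); lra.
Qed.

Lemma bform_cvg beta a a0 c c0 : bform beta ->
  (\forall h \near 0^'+, X (a h)) -> X a0 -> (\forall h \near 0^'+, X (c h)) -> X c0 ->
  ncvg a a0 -> ncvg c c0 -> beta (a h) (c h) @[h --> 0^'+] --> beta a0 c0.
Proof.
move=> hf Xa Xa0 Xc Xc0 la lc; have [C C0 hC] := bf_bnd _ hf.
pose g h := C * (N (a h - a0) * N (c h - c0) + N (a h - a0) * N c0 + N a0 * N (c h - c0)).
have g0 : g h @[h --> 0^'+] --> (0 : R).
  suff : g h @[h --> 0^'+] --> C * (0 * 0 + 0 * N c0 + N a0 * 0).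
    by rewrite !mul0r mulr0 !addr0 mulr0.
  have cst (y : R) : y @[_ --> (0 : R)^'+] --> y by exact: cvg_cst.
  apply: cvgM; first exact: cst.
  apply: cvgD; last by apply: cvgM; [exact: cst|exact: lc].
  by apply: cvgD; apply: cvgM; [exact: la|exact: lc|exact: la|exact: cst].
apply: (@squeeze_cvgr _ _ _ _ (fun h => beta a0 c0 - g h) (fun h => beta a0 c0 + g h)).
- near=> h; have Xah : X (a h) by near: h. have Xch : X (c h) by near: h.
  have XA := lsubB _ sX _ _ Xah Xa0; have XC := lsubB _ sX _ _ Xch Xc0.
  have e : beta (a h) (c h) - beta a0 c0 = beta (a h - a0) (c h - c0) +
     beta (a h - a0) c0 + beta a0 (c h - c0).
    rewrite !(bf_Br beta, bf_Bl beta) //; ring.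
  have h1 := hC _ _ XA XC; have h2 := hC _ _ XA Xc0; have h3 := hC _ _ Xa0 XC.
  rewrite -ler_distl e /g.
  apply: le_trans (ler_normD _ _) _; apply: le_trans (lerD (ler_normD _ _) (lexx _)) _.
  lra.
- rewrite -[X in _ --> X]subr0; apply: cvgB => //; exact: cvg_cst.
- rewrite -[X in _ --> X]addr0; apply: cvgD => //; exact: cvg_cst.
Unshelve. all: by end_near. Qed.

(** [sg_bnd] bounds each operator separately; uniformity for small times comes from
    [locally_bounded]. *)
Record c0_semigroup (T : R -> V -> V) : Prop := C0Semigroup {
  sg_lin : forall t, 0 <= t -> lin_on X (T t);
  sg_bnd : forall t, 0 <= t -> exists M : R, forall u, X u -> N (T t u) <= M * N u;
  sg_0 : forall u, X u -> T 0 u = u;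
  sg_add : forall s t u, 0 <= s -> 0 <= t -> X u -> T (s + t) u = T s (T t u);
  sg_cont : forall u, X u -> forall e : R, 0 < e -> exists2 d : R, 0 < d &
    forall h, 0 <= h -> h < d -> N (T h u - u) < e }.

Variables (T : R -> V -> V) (hT : c0_semigroup T) (cX : scomplete X b).

Lemma sgX t u : 0 <= t -> X u -> X (T t u).
Proof. by move=> t0; exact: lin_onX (sg_lin _ hT _ t0) u. Qed.

Lemma sg_bnd_ge0 t : 0 <= t -> exists2 M : R, 0 <= M & forall u, X u -> N (T t u) <= M * N u.
Proof.
move=> /(sg_bnd _ hT)[M hM]; exists (`|M|) => // u Xu.
by apply: le_trans (hM u Xu) _; rewrite ler_wpM2r ?snorm_ge0 // ler_norm.
Qed.

(** Otherwise there are times [s_ n] tending to 0 at which the operator norms exceed [c n]. The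
    vector given by [gliding_hump] then has an unbounded orbit along [s_ n], against strong
    continuity at 0. *)
Lemma locally_bounded : exists2 d : R, 0 < d & exists2 M : R, 0 <= M &
  forall s u, 0 <= s -> s < d -> X u -> N (T s u) <= M * N u.
Proof.
apply: contrapT => H.
(* The factor 6 * 3 ^+ n offsets the loss in [gliding_hump], so that [N (T (s_ n) x)] is at least n
   + 1. *)
pose c (n : nat) : R := 6 * n.+1%:R * 3 ^+ n.
have c0 n : 0 < c n by rewrite !mulr_gt0 // exprn_gt0.
have /choice [s_ s_P] : forall n : nat, exists s : R, [/\ 0 <= s, s < n.+1%:R^-1 &
    ~ forall u, X u -> N (T s u) <= c n * N u].
  move=> n; apply: contrapT => Hn; apply: H; exists n.+1%:R^-1.
    by rewrite invr_gt0.
  exists (c n); first exact: ltW.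
  move=> s u s0 s1; move: u; apply: contrapT => Hs; apply: Hn; by exists s.
have s0 n : 0 <= s_ n by case: (s_P n).
have /choice [p_ p_P] : forall n : nat, exists p : R * V, [/\ c n <= p.1, X p.2,
   N p.2 <= 1, (forall u, X u -> N (T (s_ n) u) <= p.1 * N u) &
                  2 / 3 * p.1 <= N (T (s_ n) p.2)].
  move=> n; have [M hM] := sg_bnd _ hT _ (s0 n); have [_ _ hn] := s_P n.
  have [a [w ?]] := norming_vector _ _ hb _ (sg_lin _ hT _ (s0 n)) _ _ hM (c0 n) hn.
  by exists (a, w).
have [||||||x Xx hx] := gliding_hump _ _ hb (fun n => T (s_ n)) (fun n => (p_ n).1)
  (fun n => (p_ n).2) cX.
- by move=> n; exact: (sg_lin _ hT).
- by move=> n; have [h _ _ _ _] := p_P n; apply: le_trans h; exact: ltW.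
- by move=> n; have [_ _ _ h _] := p_P n.
- by move=> n; have [_ h _ _ _] := p_P n.
- by move=> n; have [_ _ h _ _] := p_P n.
- by move=> n; have [_ _ _ _ h] := p_P n.
have [d d0 hd] := sg_cont _ hT _ Xx _ ltr01.
have [n0 hn0] := invS_small _ d0.
pose n := maxn n0 (Num.truncn (N x + 1)).
have h1 : N (T (s_ n) x - x) < 1.
  have [_ h _] := s_P n; apply: hd => //; apply: lt_trans h _.
  by apply: hn0; exact: leq_maxl.
have h2 : N x + 1 < n.+1%:R.
  by rewrite (lt_le_trans (truncnS_gt _)) // ler_nat ltnS leq_maxr.
have h3 := hx n; have [h4 _ _ _ _] := p_P n.
have h5 : n.+1%:R <= (p_ n).1 * 3^-1 ^+ n / 6.
  rewrite exprVn ler_pdivlMr // ler_pdivlMr ?exprn_gt0 //.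
  by rewrite [_ * 6]mulrC.
have Xt := sgX _ _ (s0 n) Xx.
have := ler_snormD _ _ hb _ _ (lsubB _ sX _ _ Xt Xx) Xx; rewrite subrK.
move: h2 h5; move: (n.+1%:R : R) => i; lra.
Qed.

Lemma ncvg_comp t a a0 : 0 <= t -> (\forall h \near 0^'+, X (a h)) -> X a0 -> ncvg a a0 ->
  ncvg (fun h => T t (a h)) (T t a0).
Proof.
move=> t0 Xa Xa0 ha; have [M M0 hM] := sg_bnd_ge0 _ t0.
apply: (@squeeze_cvgr _ _ _ _ (fun=> 0) (fun h => M * N (a h - a0))).
- near=> h; have Xah : X (a h) by near: h.
  rewrite snorm_ge0 /= -(lin_onB _ _ hb _ (sg_lin _ hT _ t0)) //.
  by apply: hM; exact: lsubB.
- exact: cvg_cst.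
- rewrite -[X in _ --> X](mulr0 M); apply: cvgM => //; exact: cvg_cst.
Unshelve. all: by end_near. Qed.

Lemma ncvg_T0 u : X u -> ncvg (fun h => T h u) u.
Proof.
move=> Xu; apply/cvg_right0P => e e0.
have [d d0 hd] := sg_cont _ hT _ Xu _ e0; exists d => // h h0 hhd.
by rewrite subr0 ger0_norm ?snorm_ge0 //; apply: hd => //; exact: ltW.
Qed.

Lemma near_right0_ge0 (P : R -> Prop) : (forall h, 0 <= h -> P h) ->
  \forall h \near 0^'+, P h.
Proof.
by move=> hP; near=> h; apply: hP; apply: ltW; near: h; exact: nbhs_right_gt.
Unshelve. all: by end_near. Qed.

Lemma ncvg_right t u : 0 <= t -> X u -> ncvg (fun h => T (t + h) u) (T t u).
Proof.
move=> t0 Xu.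
have : ncvg (fun h => T t (T h u)) (T t u).
  apply: ncvg_comp => //; last exact: ncvg_T0.
  by apply: near_right0_ge0 => h h0; exact: sgX.
apply: cvg_trans; apply: near_eq_cvg; apply: near_right0_ge0 => h h0.
by rewrite (sg_add _ hT).
Qed.

(* [T (t - h) u - T t u = - T (t - h) (T h u - u)], and the norm of [T (t - h)] is
   controlled for small [h] by that of [T (t - d)]. *)
Lemma ncvg_left t u : 0 < t -> X u -> ncvg (fun h => T (t - h) u) (T t u).
Proof.
move=> t0 Xu; have [d d0 [M M0 hM]] := locally_bounded.
pose d' := Num.min (d / 2) t.
have d'0 : 0 < d' by rewrite lt_min divr_gt0.
have d't : d' <= t by rewrite ge_min lexx orbT.
have d'd : d' <= d / 2 by rewrite ge_min lexx.
have td : 0 <= t - d' by lra.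
have [M1 M10 hM1] := sg_bnd_ge0 _ td.
apply: (@squeeze_cvgr _ _ _ _ (fun=> 0) (fun h => M1 * M * N (T h u - u))).
- near=> h; rewrite snorm_ge0 /=.
  have h0 : 0 <= h by apply: ltW; near: h; exact: nbhs_right_gt.
  have hd : h <= d' by apply: ltW; near: h; exact: nbhs_right_lt.
  have dh : 0 <= d' - h by lra.
  have th : 0 <= t - h by lra.
  have XTh := sgX _ _ h0 Xu.
  have XD := lsubB _ sX _ _ XTh Xu.
  have -> : T t u = T (t - h) (T h u) by rewrite -(sg_add _ hT) // subrK.
  have XA := sgX _ _ th Xu; have XB := sgX _ _ th XTh.
  rewrite (snormBC _ _ hb _ _ XA XB) -(lin_onB _ _ hb _ (sg_lin _ hT _ th)) //.
  have -> : t - h = (t - d') + (d' - h) by lra.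
  rewrite (sg_add _ hT) //; apply: le_trans (hM1 _ (sgX _ _ dh XD)) _.
  rewrite -mulrA ler_wpM2l //; apply: hM => //; lra.
- exact: cvg_cst.
- rewrite -[X in _ --> X](mulr0 (M1 * M)); apply: cvgM; first exact: cvg_cst.
  exact: ncvg_T0.
Unshelve. all: by end_near. Qed.

(** The generator as a relation, so that one limit carries both its domain and its values. *)
Definition gen_at (u u' : V) : Prop := ncvg (fun h => h^-1 *: (T h u - u)) u'.

Lemma gen_at_T t u u' : 0 <= t -> X u -> X u' -> gen_at u u' -> gen_at (T t u) (T t u').
Proof.
move=> t0 Xu Xu' hu.
have : ncvg (fun h => T t (h^-1 *: (T h u - u))) (T t u').
  apply: ncvg_comp => //; apply: near_right0_ge0 => h h0.
  by apply: lsubZ => //; apply: lsubB => //; exact: sgX.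
apply: cvg_trans; apply: near_eq_cvg; apply: near_right0_ge0 => h h0.
have L := sg_lin _ hT _ t0; have Xh := sgX _ _ h0 Xu.
rewrite (lin_onZ _ _ hb _ L) ?(lin_onB _ _ hb _ L) //; last exact: lsubB.
by rewrite -(sg_add _ hT t h) // -(sg_add _ hT h t) // [t + h]addrC.
Qed.

(** The product rule: the increment of the form is that of the first orbit paired with
    [T (t + h) v], plus [T t u] paired with that of the second. Left continuity rests on
    [ncvg_left]. *)
Lemma rdiff_orbit beta u u' v v' : bform beta -> X u -> X u' -> X v -> X v' ->
  gen_at u u' -> gen_at v v' ->
  rdiff (fun t => beta (T t u) (T t v))
        (fun t => beta (T t u') (T t v) + beta (T t u) (T t v')).
Proof.
move=> hf Xu Xu' Xv Xv' gu gv t t0; split; last first.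
  move=> tp; apply: bform_cvg => //; try exact: sgX; try exact: ncvg_left;
  near=> h; apply: sgX => //; rewrite subr_ge0; apply: ltW;
  near: h; exact: nbhs_right_lt.
have q w h : 0 <= h -> X w -> X (h^-1 *: (T (t + h) w - T t w)).
  move=> h0 Xw; apply: lsubZ => //; apply: lsubB => //; apply: sgX => //.
  exact: addr_ge0.
have dq w w' : X w -> X w' -> gen_at w w' ->
    ncvg (fun h => h^-1 *: (T (t + h) w - T t w)) (T t w').
  move=> Xw Xw' /gen_at_T - /(_ _ t0 Xw Xw').
  apply: cvg_trans; apply: near_eq_cvg; apply: near_right0_ge0 => h h0.
  by rewrite [t + h]addrC (sg_add _ hT).
have : beta (h^-1 *: (T (t + h) u - T t u)) (T (t + h) v) +
       beta (T t u) (h^-1 *: (T (t + h) v - T t v)) @[h --> 0^'+] -->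
       beta (T t u') (T t v) + beta (T t u) (T t v').
  apply: cvgD; apply: bform_cvg => //; try exact: sgX; try exact: dq;
    try exact: ncvg_right; try by apply: near_right0_ge0 => h h0; exact: q.
  - by apply: near_right0_ge0 => h h0; apply: sgX => //; exact: addr_ge0.
  - by apply: near_right0_ge0 => h h0; exact: sgX.
  - by rewrite /ncvg subrr (snorm0 _ _ hb); exact: cvg_cst.
apply: cvg_trans; apply: near_eq_cvg; apply: near_right0_ge0 => h h0.
have th := addr_ge0 t0 h0.
have XA := sgX _ _ th Xu; have XB := sgX _ _ th Xv.
have XC := sgX _ _ t0 Xu; have XD := sgX _ _ t0 Xv.
rewrite (bf_Zl _ _ _ _ hf) ?(bf_Zr _ _ _ _ hf) //; try exact: lsubB.
rewrite (bf_Bl _ _ _ _ hf) ?(bf_Br _ _ _ _ hf) //; ring.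
Unshelve. all: by end_near. Qed.

(** For [u] in the domain the right derivative of [b (T t u) (T t u)] is nonpositive. Density
    extends the inequality to [X], because each [T t] is bounded. *)
Lemma dissipative_contraction :
  (forall u u', X u -> X u' -> gen_at u u' -> b u' u <= 0) ->
  (forall x, X x -> forall e : R, 0 < e -> exists u u',
     [/\ X u, X u', gen_at u u' & N (x - u) < e]) ->
  forall t x, 0 <= t -> X x -> N (T t x) <= N x.
Proof.
move=> diss dense.
have onD t u u' : 0 <= t -> X u -> X u' -> gen_at u u' -> N (T t u) <= N u.
  move=> t0 Xu Xu' gu; rewrite -ler_sqr ?nnegrE ?snorm_ge0 //.
  rewrite !(sqr_snorm _ _ hb) //; last exact: sgX.
  rewrite -{3 4}(sg_0 _ hT u Xu).
  apply: (rdiff_decr _ _ _ (rdiff_orbit _ _ _ _ _ bform_inner Xu Xu' Xu Xu' gu gu)) => //.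
  move=> s s0 _; have := diss _ _ (sgX _ _ s0 Xu) (sgX _ _ s0 Xu') (gen_at_T _ _ _ s0 Xu Xu' gu).
  rewrite (si_sym _ _ hb (T s u) (T s u')); [lra|exact: sgX|exact: sgX].
move=> t x t0 Xx; have [M M0 hM] := sg_bnd_ge0 _ t0.
apply/ler_addgt0Pr => e e0.
have M2 : 0 < M + 1 by lra.
have [|u [u' [Xu Xu' gu xu]]] := dense _ Xx (e / (M + 1)); first exact: divr_gt0.
have XB := lsubB _ sX _ _ Xx Xu.
have h1 := hM _ XB.
have h2 := ler_snormD _ _ hb _ _ (sgX _ _ t0 XB) (sgX _ _ t0 Xu).
rewrite -(lin_onD _ _ (sg_lin _ hT _ t0)) // subrK in h2.
have h3 := onD _ _ _ t0 Xu Xu' gu.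
have h4 := ler_snorm_dist _ _ hb _ _ _ Xu Xx (lsub0 _ sX).
rewrite !subr0 (snormBC _ _ hb u) // in h4.
have h5 : N (x - u) * (M + 1) <= e by rewrite -ler_pdivlMr // ltW.
lra.
Qed.

End Semigroup.

(** * Self-adjoint operators and the energy space *)

Section StateModule.
Context (R : realType) (H : normedModType R).
Implicit Types U W Z : St H.

(** The module operations are convertible to [st_add] and [st_scale], so the abstract theory applies
    to the states of the statement; [st_subE] bridges the two forms of subtraction. *)
HB.instance Definition _ := gen_eqMixin (St H).
HB.instance Definition _ := gen_choiceMixin (St H).

Let st_opp U := MkSt (- s_u U) (- s_p U) (- s_v U) (- s_q U).
Let st0 : St H := MkSt 0 0 0 0.

Let st_addA : associative (@st_add R H).
Proof. by move=> U W Z; rewrite /st_add /= !addrA. Qed.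
Let st_addC : commutative (@st_add R H).
Proof. by move=> U W; rewrite /st_add /=; congr MkSt; exact: addrC. Qed.
Let st_add0 : left_id st0 (@st_add R H).
Proof. by case=> u p v q; rewrite /st_add /= !add0r. Qed.
Let st_addN : left_inverse st0 st_opp (@st_add R H).
Proof. by move=> U; rewrite /st_add /= !addNr. Qed.
HB.instance Definition _ := GRing.isZmodule.Build (St H) st_addA st_addC st_add0 st_addN.

Let st_scaleA (a c : R) U : st_scale a (st_scale c U) = st_scale (a * c) U.
Proof. by rewrite /st_scale /= !scalerA. Qed.
Let st_scale1 : left_id 1 (@st_scale R H).
Proof. by case=> u p v q; rewrite /st_scale /= !scale1r. Qed.
Let st_scaleDr : right_distributive (@st_scale R H) +%R.
Proof. by move=> a U W; rewrite /st_scale /= !scalerDr. Qed.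
Let st_scaleDl U : {morph (@st_scale R H)^~ U : a c / a + c}.
Proof. by move=> a c; rewrite /st_scale /= !scalerDl. Qed.
HB.instance Definition _ := GRing.Zmodule_isLmodule.Build R (St H)
  st_scaleA st_scale1 st_scaleDr st_scaleDl.

Lemma st_addE U W : st_add U W = U + W. Proof. by []. Qed.
Lemma st_subE U W : st_add U (st_scale (-1) W) = U - W.
Proof. by rewrite -[st_add _ _]/(U + (-1) *: W) scaleN1r. Qed.
End StateModule.

Section Operators.
Context {R : realType} {H : completeNormedModType R}.
Variables (ip : H -> H -> R) (hip_ok : is_inner ip).

Lemma ip_semi_inner : semi_inner setT ip.
Proof.
case: hip_ok => [sy [li no]]; split => //.
by move=> u _; rewrite -no sqr_ge0.
Qed.
Let hI := ip_semi_inner.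

Lemma ip_norm u : snorm ip u = `|u|.
Proof. by case: hip_ok => [_ [_ no]]; rewrite /snorm -no sqrtr_sqr normr_id. Qed.
Lemma ip_sqr u : ip u u = `|u| ^+ 2.
Proof. by case: hip_ok => [_ [_ no]]. Qed.
Lemma ipC u v : ip u v = ip v u. Proof. by case: hip_ok. Qed.
Lemma ipDl u v w : ip (u + v) w = ip u w + ip v w.
Proof. exact: (siDl _ _ hI). Qed.
Lemma ipDr u v w : ip w (u + v) = ip w u + ip w v.
Proof. exact: (siDr _ _ hI). Qed.
Lemma ipZl a u w : ip (a *: u) w = a * ip u w.
Proof. exact: (siZl _ _ hI). Qed.
Lemma ipZr a u w : ip w (a *: u) = a * ip w u.
Proof. exact: (siZr _ _ hI). Qed.
Lemma ipNl u w : ip (- u) w = - ip u w.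
Proof. by rewrite -scaleN1r ipZl mulN1r. Qed.
Lemma ipNr u w : ip w (- u) = - ip w u.
Proof. by rewrite -scaleN1r ipZr mulN1r. Qed.
Lemma ip_CS u v : `|ip u v| <= `|u| * `|v|.
Proof. by rewrite -!ip_norm; exact: (cauchy_schwarz _ _ hI). Qed.

Lemma cauchy_limit (u_ : nat -> H) :
  (forall e : R, 0 < e -> exists N0, forall m n, (N0 <= m)%N -> (N0 <= n)%N ->
     `|u_ m - u_ n| < e) ->
  exists2 u, u_ @ \oo --> u &
    forall e : R, 0 < e -> exists N0, forall n, (N0 <= n)%N -> `|u_ n - u| < e.
Proof.
move=> cau; have cv : cvg (u_ @ \oo).
  apply: cauchy_cvg; apply/cauchy_ballP => e e0.
  have [N0 hN] := cau _ e0.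
  pose tail := u_ @` [set n | (N0 <= n)%N].
  exists (tail, tail); first by split; exists N0 => // n hn; exists n.
  by move=> _ /= [[m hm <-] [n hn <-]]; rewrite -ball_normE /=; exact: hN.
exists (lim (u_ @ \oo)) => // e e0.
have /cvgrPdist_lt/(_ e e0)[N0 _ hN] := cv.
by exists N0 => n hn; rewrite distrC; exact: hN.
Qed.

Lemma ip_scomplete : scomplete setT ip.
Proof.
move=> u_ _ cau; have [|u _ hu] := cauchy_limit u_.
  by move=> e /cau [N0 h]; exists N0 => m n hm hn; rewrite -ip_norm; exact: h.
by exists u => // e /hu [N0 h]; exists N0 => n hn; rewrite ip_norm; exact: h.
Qed.

Section LinOp.
Variables (D : set H) (A : H -> H) (hA : self_adjoint ip D A).

Lemma sa_sub : lsubspace D.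
Proof.
by case: hA => [[[D0 hL] _] _]; split => // a u v Du Dv; case: (hL a u v Du Dv).
Qed.
Lemma sa_lin a u v : D u -> D v -> A (a *: u + v) = a *: A u + A v.
Proof. by case: hA => [[[D0 hL] _] _] Du Dv; case: (hL a u v Du Dv). Qed.
Lemma sa_B u v : D u -> D v -> A (u - v) = A u - A v.
Proof. by move=> Du Dv; rewrite addrC -scaleN1r sa_lin // scaleN1r addrC. Qed.
Lemma sa_closed u_ u f : (forall k, D (u_ k)) -> u_ @ \oo --> u ->
  (A \o u_) @ \oo --> f -> D u /\ A u = f.
Proof. by case: hA => [_ [+ _]]; apply. Qed.
Lemma sa_adj v w : (forall u, D u -> ip (A u) v = ip u w) -> D v.
Proof. by case: hA => [_ [_ [h _]]] hv; apply/h; exists w. Qed.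
Lemma sa_sym u v : D u -> D v -> ip (A u) v = ip u (A v).
Proof. by case: hA => [_ [_ [_ h]]]; exact: h. Qed.
Lemma sa_dense u (e : R) : 0 < e -> exists2 d, D d & `|u - d| < e.
Proof.
case: hA => [[_ clD] _] e0; have : closure D u by rewrite clD.
move=> /(_ (ball u e)) []; first exact: nbhsx_ballx.
by move=> d [Dd]; rewrite -ball_normE /=; exists d.
Qed.

(** The inner product of the graph norm; the domain is complete for it because the operator is
    closed. *)
Definition graph_form u v := ip u v + ip (A u) (A v).

Lemma graph_semi_inner : semi_inner D graph_form.
Proof.
split; first exact: sa_sub.
- by move=> u v _ _; rewrite /graph_form ipC [ip (A u) _]ipC.
- by move=> a u v w Du Dv _; rewrite /graph_form sa_lin // !(ipDl, ipZl); ring.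
- by move=> u _; rewrite /graph_form !ip_sqr addr_ge0 ?sqr_ge0.
Qed.

Lemma graph_norm_sq u : D u -> snorm graph_form u ^+ 2 = `|u| ^+ 2 + `|A u| ^+ 2.
Proof. by move=> Du; rewrite (sqr_snorm _ _ graph_semi_inner) // /graph_form !ip_sqr. Qed.

Lemma norm_le_graph u : D u -> `|u| <= snorm graph_form u.
Proof.
move=> Du; rewrite -ler_sqr ?nnegrE ?snorm_ge0 // graph_norm_sq //.
by rewrite lerDl sqr_ge0.
Qed.
Lemma norm_op_le_graph u : D u -> `|A u| <= snorm graph_form u.
Proof.
move=> Du; rewrite -ler_sqr ?nnegrE ?snorm_ge0 // graph_norm_sq //.
by rewrite lerDr sqr_ge0.
Qed.
Lemma graph_le u : D u -> snorm graph_form u <= `|u| + `|A u|.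
Proof.
move=> Du; rewrite -ler_sqr ?nnegrE ?snorm_ge0 ?addr_ge0 // graph_norm_sq //.
by have := normr_ge0 u; have := normr_ge0 (A u); nra.
Qed.

Lemma graph_scomplete : scomplete D graph_form.
Proof.
move=> u_ Du cau.
have Dd m n := lsubB _ sa_sub _ _ (Du m) (Du n).
have [|u cu hu] := cauchy_limit u_.
  move=> e /cau [N0 h]; exists N0 => m n hm hn.
  by apply: le_lt_trans (h m n hm hn); exact: norm_le_graph.
have [|f cf hf] := cauchy_limit (A \o u_).
  move=> e /cau [N0 h]; exists N0 => m n hm hn.
  by apply: le_lt_trans (h m n hm hn); rewrite /= -sa_B //; exact: norm_op_le_graph.
have [Du' Au] := sa_closed _ _ _ Du cu cf.
exists u => // e e0; have e2 : 0 < e / 2 by lra.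
have [N1 h1] := hu _ e2; have [N2 h2] := hf _ e2; exists (maxn N1 N2) => n.
rewrite geq_max => /andP[/h1 h3 /h2 h4].
apply: le_lt_trans (graph_le _ (lsubB _ sa_sub _ _ (Du n) Du')) _.
by rewrite sa_B // Au; move: h4 => /=; lra.
Qed.

(* A vector orthogonal to the range of [A] lies in the domain of the adjoint, hence in [D],
   and is killed by coercivity; coercivity also closes the range. *)
Lemma coercive_surjective (omega : R) : 0 < omega ->
  (forall u, D u -> omega * `|u| ^+ 2 <= ip (A u) u) ->
  forall f, exists2 z, D z & A z = f.
Proof.
move=> w0 hw f.
have low u : D u -> omega * `|u| <= `|A u|.
  move=> Du; have := hw u Du; have := ip_CS (A u) u.
  rewrite ler_norml => /andP[_ h1] h2.
  have [->|un0] := eqVneq u 0; first by rewrite normr0 mulr0.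
  have up : 0 < `|u| by rewrite normr_gt0.
  rewrite -(ler_pM2r up); lra.
pose M := A @` D.
have sM : lsubspace M.
  split; first exists 0; first exact: lsub0 sa_sub.
    by have := sa_B 0 0 (lsub0 _ sa_sub) (lsub0 _ sa_sub); rewrite !subrr.
  move=> a _ _ [u Du <-] [v Dv <-]; exists (a *: u + v); first exact: lsubL sa_sub _ _ _ Du Dv.
  exact: sa_lin.
have orth z : setT z -> (forall m, M m -> ip z m = 0) -> ip z z = 0.
  move=> _ hz; have Dz : D z.
    apply: (sa_adj z 0) => u Du; rewrite ipC hz; last by exists u.
    by rewrite -(scale0r u) ipZr mul0r.
  have := hw z Dz; rewrite ipC hz; last by exists z.
  by rewrite pmulr_rle0 // ip_sqr => h; apply/eqP; rewrite eq_le h sqr_ge0.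
have dns := dense_of_orthogonal _ _ hI M ip_scomplete sM (fun _ _ => I) orth f I.
have /choice [z_ z_P] : forall n : nat, exists z, D z /\ `|f - A z| < n.+1%:R^-1.
  move=> n; have [|_ [z Dz <-] h] := dns n.+1%:R^-1; first by rewrite invr_gt0.
  by exists z; rewrite ip_norm in h.
have Dz n : D (z_ n) by case: (z_P n).
have small (e : R) : 0 < e -> exists N0, forall n, (N0 <= n)%N -> `|f - A (z_ n)| < e.
  move=> /invS_small [N0 hN]; exists N0 => n /hN; apply: lt_trans.
  by case: (z_P n).
have [|z cz _] := cauchy_limit z_.
  move=> e e0; have [|N0 hN] := small (omega * e / 2); first by rewrite divr_gt0 ?mulr_gt0.
  exists N0 => m n hm hn; have h := low _ (lsubB _ sa_sub _ _ (Dz m) (Dz n)).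
  rewrite sa_B // in h.
  have := ler_distD f (A (z_ m)) (A (z_ n)); rewrite [`|A (z_ m) - f|]distrC.
  have := hN m hm; have := hN n hn => h1 h2 h3.
  rewrite -(ltr_pM2l w0); lra.
have cf : (A \o z_) @ \oo --> f.
  apply/cvgrPdist_lt => e /small [N0 hN]; exists N0 => // n /= hn; exact: hN.
by have [Dz' Az] := sa_closed _ _ _ Dz cz cf; exists z.
Qed.
End LinOp.

(** * Square roots of coercive operators *)

Section Sqrt.
Variables (D : set H) (A : H -> H) (E : set H) (S : H -> H) (omega : R).
Hypotheses (hA : self_adjoint ip D A) (hS : is_sqrt_op ip D A E S).
Hypotheses (w0 : 0 < omega) (hw : forall u, D u -> omega * `|u| ^+ 2 <= ip (A u) u).

Lemma sqrt_sa : self_adjoint ip E S. Proof. by case: hS. Qed.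
Lemma sqrt_dom u : D u -> E u. Proof. by case: hS => _ [_ [h _]] /h []. Qed.
Lemma sqrt_dom2 u : D u -> E (S u). Proof. by case: hS => _ [_ [h _]] /h []. Qed.
Lemma sqrt_form u v : D u -> E v -> ip (A u) v = ip (S u) (S v).
Proof.
move=> Du Ev; case: (hS) => sS [_ [_ ->]] //.
by rewrite (sa_sym _ _ sS) //; exact: sqrt_dom2.
Qed.

(** [D] is a core of [S]: if [z] is orthogonal to [D] for the graph form, then <A m, z> = <m, - z>
    on [D], so [z] is in the domain of the adjoint, which is [D], and is orthogonal to itself. *)
Lemma sqrt_core u (e : R) : E u -> 0 < e -> exists d, [/\ D d, `|u - d| < e & `|S (u - d)| < e].
Proof.
move=> Eu e0.
have orth z : E z -> (forall m, D m -> graph_form S z m = 0) -> graph_form S z z = 0.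
  move=> Ez hz; apply: (hz); apply: (sa_adj _ _ hA z (- z)) => m Dm.
  have := hz m Dm; rewrite /graph_form => h.
  by rewrite sqrt_form // ipC ipNr [ip m z]ipC; lra.
have [d Dd hd] := dense_of_orthogonal _ _ (graph_semi_inner _ _ sqrt_sa) D
  (graph_scomplete _ _ sqrt_sa) (sa_sub _ _ hA) sqrt_dom orth u Eu e e0.
have Ed := lsubB _ (sa_sub _ _ sqrt_sa) _ _ Eu (sqrt_dom _ Dd).
exists d; split => //; apply: le_lt_trans hd.
- exact: norm_le_graph sqrt_sa _ Ed.
- exact: norm_op_le_graph sqrt_sa _ Ed.
Qed.

(** On [D] this is the coercivity of [A], as <A u, u> = |S u|^2; the core property extends it to
    [E]. *)
Lemma sqrt_coercive u : E u -> Num.sqrt omega * `|u| <= `|S u|.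
Proof.
set s := Num.sqrt omega => Eu.
have s0 : 0 <= s by exact: sqrtr_ge0.
have onD d : D d -> s * `|d| <= `|S d|.
  move=> Dd; rewrite -ler_sqr ?nnegrE ?mulr_ge0 // exprMn sqr_sqrtr; last exact: ltW.
  rewrite -[`|S d| ^+ 2]ip_sqr -(sqrt_form d d Dd (sqrt_dom _ Dd)).
  exact: hw.
apply/ler_addgt0Pr => e e0.
have s1 : 0 < s + 1 by lra.
have [|d [Dd h1 h2]] := sqrt_core u (e / (s + 1)) Eu; first exact: divr_gt0.
have e1 : e / (s + 1) * (s + 1) = e by rewrite divfK // gt_eqF.
move: h1 h2 e1; move: (e / (s + 1)) => e' h1 h2 e1.
have h3 := onD d Dd.
have Ed := sqrt_dom _ Dd.
rewrite (sa_B _ _ sqrt_sa) // in h2.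
have h4 := ler_normD (u - d) d; rewrite subrK in h4.
have h5 := ler_normB (S u) (S u - S d); rewrite subKr in h5.
nra.
Qed.
End Sqrt.
End Operators.

(** * The energy space and its dissipation identity *)

Section EnergySpace.
Context {R : realType} {H : completeNormedModType R}.
Variables (ip : H -> H -> R) (hip_ok : is_inner ip).
Variables (D1 : set H) (A1 : H -> H) (D2 : set H) (A2 : H -> H).
Variables (E1 : set H) (S1 : H -> H) (E2 : set H) (S2 : H -> H).
Variables (B : H -> H) (omega1 omega2 alpha : R).
Hypotheses (hA1 : self_adjoint ip D1 A1) (hA2 : self_adjoint ip D2 A2).
Hypotheses (hom1 : 0 < omega1) (hom2 : 0 < omega2).
Hypotheses (hA1c : forall u, D1 u -> ip (A1 u) u >= omega1 * `|u| ^+ 2).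
Hypotheses (hA2c : forall u, D2 u -> ip (A2 u) u >= omega2 * `|u| ^+ 2).
Hypotheses (hS1 : is_sqrt_op ip D1 A1 E1 S1) (hS2 : is_sqrt_op ip D2 A2 E2 S2).
Hypothesis halpha : 0 < `|alpha| < Num.sqrt (omega1 * omega2).

Local Notation X := (inHH E1 E2).
Local Notation b := (hip ip S1 S2 alpha).
Local Notation N := (snorm b).
Local Notation DA := (DAA D1 E1 D2 E2).
Local Notation G := (AA A1 A2 B alpha).
Let sa1 := sqrt_sa _ _ _ _ _ hS1.
Let sa2 := sqrt_sa _ _ _ _ _ hS2.
Let sE1 := sa_sub _ _ _ sa1.
Let sE2 := sa_sub _ _ _ sa2.

Lemma energy_lsubspace : lsubspace X.
Proof.
split; first by split; [exact: lsub0 sE1|exact: lsub0 sE2].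
move=> a U W [U1 U2] [W1 W2]; split.
- exact: lsubL sE1 _ _ _ U1 W1.
- exact: lsubL sE2 _ _ _ U2 W2.
Qed.

(** The energy without its coupling terms. The two are equivalent because the coupling is at most
    [kappa] times [qsum], with kappa < 1. *)
Definition qsum (U : St H) : R :=
  `|S1 (s_u U)| ^+ 2 + `|s_p U| ^+ 2 + `|S2 (s_v U)| ^+ 2 + `|s_q U| ^+ 2.

Let s1 : R := Num.sqrt omega1.
Let s2 : R := Num.sqrt omega2.
Let s10 : 0 < s1. Proof. by rewrite sqrtr_gt0. Qed.
Let s20 : 0 < s2. Proof. by rewrite sqrtr_gt0. Qed.

Let kappa : R := `|alpha| / (s1 * s2).
Let kappa_lt1 : kappa < 1.
Proof.
case/andP: halpha => _ h; rewrite /kappa ltr_pdivrMr ?mulr_gt0 // mul1r.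
by rewrite /s1 /s2 -sqrtrM // ltW.
Qed.
Let kappa_ge0 : 0 <= kappa.
Proof. by rewrite divr_ge0 // mulr_ge0 // ltW. Qed.

(** Coercivity of the two square roots bounds s1 s2 |u| |v| by |S1 u| |S2 v|, and 2 x y <= x^2 + y^2
    concludes. *)
Let cross U : X U -> `|2 * alpha * ip (s_u U) (s_v U)| <= kappa * qsum U.
Proof.
move=> [U1 U2].
have h1 := sqrt_coercive _ hip_ok _ _ _ _ _ hA1 hS1 hom1 hA1c _ U1.
have h2 := sqrt_coercive _ hip_ok _ _ _ _ _ hA2 hS2 hom2 hA2c _ U2.
have h3 := ip_CS _ hip_ok (s_u U) (s_v U).
rewrite !normrM (ger0_norm (ltW _)) //.
have -> : `|alpha| = kappa * (s1 * s2) by rewrite /kappa divfK // gt_eqF // mulr_gt0.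
apply: (@le_trans _ _ (kappa * (2 * ((s1 * `|s_u U|) * (s2 * `|s_v U|))))).
  have h : s1 * s2 * `|ip (s_u U) (s_v U)| <= s1 * s2 * (`|s_u U| * `|s_v U|).
    by rewrite ler_pM2l // mulr_gt0.
  by have := ler_wpM2l kappa_ge0 h; lra.
apply: ler_wpM2l => //.
have h4 : s1 * `|s_u U| * (s2 * `|s_v U|) <= `|S1 (s_u U)| * `|S2 (s_v U)|.
  by apply: ler_pM => //; rewrite mulr_ge0 // ltW.
have := sqr_ge0 (`|S1 (s_u U)| - `|S2 (s_v U)|).
have := sqr_ge0 (`|s_p U|); have := sqr_ge0 (`|s_q U|); rewrite /qsum; lra.
Qed.

Lemma hip_diag U : b U U = qsum U + 2 * alpha * ip (s_u U) (s_v U).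
Proof. by rewrite /hip /qsum !(ip_sqr _ hip_ok) (ipC _ hip_ok (s_v U)); ring. Qed.

Lemma qsum_ge0 U : 0 <= qsum U.
Proof. by rewrite /qsum !addr_ge0 ?sqr_ge0. Qed.

Lemma energy_semi_inner : semi_inner X b.
Proof.
split; first exact: energy_lsubspace.
- move=> U W _ _; rewrite /hip.
  rewrite (ipC _ hip_ok (s_p U)) (ipC _ hip_ok (s_q U)) (ipC _ hip_ok (S1 _)).
  rewrite (ipC _ hip_ok (S2 _)) (ipC _ hip_ok (s_u U)) (ipC _ hip_ok (s_v U)); ring.
- move=> a U W Z [U1 U2] [W1 W2] _; rewrite /hip /=.
  rewrite (sa_lin _ _ _ sa1) // (sa_lin _ _ _ sa2) //.
  rewrite !(ipDl _ hip_ok, ipZl _ hip_ok); ring.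
- move=> U XU; rewrite hip_diag.
  have := cross U XU; rewrite ler_norml => /andP[h _].
  have := ler_wpM2r (qsum_ge0 U) (ltW kappa_lt1); have := qsum_ge0 U; lra.
Qed.
Let hb := energy_semi_inner.

Lemma energy_coercive : exists2 K : R, 0 < K & forall U, X U -> qsum U <= (K * N U) ^+ 2.
Proof.
have k0 : 0 < 1 - kappa by rewrite subr_gt0.
exists (Num.sqrt (1 - kappa)^-1); first by rewrite sqrtr_gt0 invr_gt0.
move=> U XU; rewrite exprMn sqr_sqrtr; last by rewrite invr_ge0 ltW.
rewrite ler_pdivlMl //.
rewrite (sqr_snorm _ _ hb) // hip_diag.
have := cross U XU; rewrite ler_norml => /andP[h _]; lra.
Qed.

Lemma energy_le U : X U -> N U ^+ 2 <= 2 * qsum U.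
Proof.
move=> XU; rewrite (sqr_snorm _ _ hb) // hip_diag.
have := cross U XU; rewrite ler_norml => /andP[_ h].
have := ler_wpM2r (qsum_ge0 U) (ltW kappa_lt1); have := qsum_ge0 U; lra.
Qed.

(** Bounded linear observations of a state; pairing two of them gives a bounded form by
    [bform_ip]. *)
Definition blin (L : St H -> H) : Prop :=
  (forall a U W, X U -> X W -> L (a *: U + W) = a *: L U + L W) /\
  exists2 K : R, 0 < K & forall U, X U -> `|L U| <= K * N U.

Let blin_comp (L : St H -> H) :
  (forall a U W, X U -> X W -> L (a *: U + W) = a *: L U + L W) ->
  (forall U, X U -> `|L U| ^+ 2 <= qsum U) -> blin L.
Proof.
move=> hl hq; split => //; have [K K0 hK] := energy_coercive; exists K => // U XU.
rewrite -ler_sqr ?nnegrE ?mulr_ge0 ?snorm_ge0 ?(ltW K0) //.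
exact: le_trans (hq U XU) (hK U XU).
Qed.

Lemma blin_S1u : blin (S1 \o @s_u H).
Proof.
apply: blin_comp => [a U W [U1 _] [W1 _]|U _] /=; first exact: sa_lin sa1 _ _ _ U1 W1.
by rewrite /qsum -!addrA lerDl !addr_ge0 ?sqr_ge0.
Qed.
Lemma blin_p : blin (@s_p H).
Proof.
apply: blin_comp => // U _; rewrite /qsum.
have := sqr_ge0 (`|S1 (s_u U)|); have := sqr_ge0 (`|S2 (s_v U)|).
by have := sqr_ge0 (`|s_q U|); lra.
Qed.
Lemma blin_S2v : blin (S2 \o @s_v H).
Proof.
apply: blin_comp => [a U W [_ U1] [_ W1]|U _] /=; first exact: sa_lin sa2 _ _ _ U1 W1.
rewrite /qsum; have := sqr_ge0 (`|S1 (s_u U)|); have := sqr_ge0 (`|s_p U|).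
by have := sqr_ge0 (`|s_q U|); lra.
Qed.
Lemma blin_q : blin (@s_q H).
Proof.
apply: blin_comp => // U _; rewrite /qsum.
have := sqr_ge0 (`|S1 (s_u U)|); have := sqr_ge0 (`|S2 (s_v U)|).
by have := sqr_ge0 (`|s_p U|); lra.
Qed.

Let blin_dom (L M : St H -> H) (c : R) : 0 < c -> blin M ->
  (forall a U W, X U -> X W -> L (a *: U + W) = a *: L U + L W) ->
  (forall U, X U -> `|L U| <= c * `|M U|) -> blin L.
Proof.
move=> c0 [_ [K K0 hK]] hl hc; split => //; exists (c * K); first exact: mulr_gt0.
move=> U XU; apply: le_trans (hc U XU) _; rewrite -mulrA ler_pM2l //; exact: hK.
Qed.

Lemma blin_u : blin (@s_u H).
Proof.
apply: (blin_dom _ _ s1^-1 _ blin_S1u) => //; first by rewrite invr_gt0.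
move=> U [U1 _] /=; rewrite mulrC ler_pdivlMr // mulrC.
exact: (sqrt_coercive _ hip_ok _ _ _ _ _ hA1 hS1 hom1 hA1c _ U1).
Qed.
Lemma blin_v : blin (@s_v H).
Proof.
apply: (blin_dom _ _ s2^-1 _ blin_S2v) => //; first by rewrite invr_gt0.
move=> U [_ U2] /=; rewrite mulrC ler_pdivlMr // mulrC.
exact: (sqrt_coercive _ hip_ok _ _ _ _ _ hA2 hS2 hom2 hA2c _ U2).
Qed.
Lemma blin_post (L : St H -> H) (F : H -> H) (c : R) : blin L ->
  (forall (a : R) u v, F (a *: u + v) = a *: F u + F v) ->
  (forall u, `|F u| <= c * `|u|) -> blin (F \o L).
Proof.
move=> bL Fl Fc; have c0 : 0 < `|c| + 1 by rewrite ltr_wpDl.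
apply: (blin_dom _ _ _ c0 bL) => [a U W XU XW|U XU] /=.
  by case: bL => Ll _; rewrite Ll.
apply: le_trans (Fc _) _; apply: ler_wpM2r => //.
by have := ler_norm c; lra.
Qed.

Lemma bform_ip L M : blin L -> blin M -> bform X b (fun U W => ip (L U) (M W)).
Proof.
move=> [Ll [K K0 hK]] [Ml [K' K'0 hK']]; split.
- by move=> a U W Z XU XW XZ; rewrite Ll // (ipDl _ hip_ok) (ipZl _ hip_ok).
- by move=> a U W Z XU XW XZ; rewrite Ml // (ipDr _ hip_ok) (ipZr _ hip_ok).
exists (K * K'); first by rewrite mulr_ge0 // ltW.
move=> U W XU XW; apply: le_trans (ip_CS _ hip_ok _ _) _.
by rewrite mulrACA ler_pM //; [exact: hK|exact: hK'].
Qed.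

(** The components of a Cauchy sequence converge in [H], and so do [S1 u] and [S2 v]; closedness of
    the roots places the limits in [E1] and [E2]. *)
Lemma energy_scomplete : scomplete X b.
Proof.
move=> U_ XU cau; have [K K0 hK] := energy_coercive.
have Xd m n := lsubB _ energy_lsubspace _ _ (XU m) (XU n).
have comp L : blin L -> forall e : R, 0 < e -> exists N0, forall m n,
    (N0 <= m)%N -> (N0 <= n)%N -> `|L (U_ m) - L (U_ n)| < e.
  move=> [Ll [K' K'0 hK']] e e0; have [|N0 hN] := cau (e / K'); first exact: divr_gt0.
  exists N0 => m n hm hn; have := hN m n hm hn; rewrite ltr_pdivlMr // => h.
  have -> : L (U_ m) - L (U_ n) = L (U_ m - U_ n).
    by rewrite [U_ m - _]addrC -[- U_ n]scaleN1r Ll // scaleN1r addrC.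
  by apply: le_lt_trans (hK' _ (Xd m n)) _; rewrite mulrC.
have graph E S (L : St H -> H) : self_adjoint ip E S -> (forall n, E (L (U_ n))) ->
    blin L -> blin (S \o L) ->
    exists2 u, E u & forall e : R, 0 < e -> exists N0, forall n, (N0 <= n)%N ->
       `|S (L (U_ n) - u)| < e.
  move=> hE EL bL bSL.
  have [u cu _] := cauchy_limit _ (comp _ bL).
  have [f cf hf] := cauchy_limit _ (comp _ bSL).
  have [Eu Su] := sa_closed _ _ _ hE (fun n => L (U_ n)) u f EL cu cf.
  exists u => // e /hf [N0 h]; exists N0 => n hn.
  by rewrite (sa_B _ _ _ hE) // Su; exact: h.
have [u Eu hu] := graph E1 S1 _ sa1 (fun n => (XU n).1) blin_u blin_S1u.
have [v Ev hv] := graph E2 S2 _ sa2 (fun n => (XU n).2) blin_v blin_S2v.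
have [p _ hp] := cauchy_limit _ (comp _ blin_p).
have [q _ hq] := cauchy_limit _ (comp _ blin_q).
exists (MkSt u p v q); first by split.
move=> e e0; have e4 : 0 < e / 4 by lra.
have [Nu hNu] := hu _ e4; have [Nv hNv] := hv _ e4.
have [Np hNp] := hp _ e4; have [Nq hNq] := hq _ e4.
exists (maxn (maxn Nu Nv) (maxn Np Nq)) => n; rewrite !geq_max.
move=> /andP[/andP[/hNu h1 /hNv h2] /andP[/hNp h3 /hNq h4]].
have Xn : X (U_ n - MkSt u p v q) by apply: (lsubB _ energy_lsubspace) => //; split.
rewrite -ltr_sqr ?nnegrE ?snorm_ge0 ?(ltW e0) //.
apply: le_lt_trans (energy_le _ Xn) _; rewrite /qsum /=.
have sq (x : R) : 0 <= x -> x < e / 4 -> x ^+ 2 < (e / 4) ^+ 2.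
  by move=> x0 xe; rewrite ltr_sqr ?nnegrE // ltW.
have := sq _ (normr_ge0 _) h1; have := sq _ (normr_ge0 _) h2.
have := sq _ (normr_ge0 _) h3; have := sq _ (normr_ge0 _) h4; nra.
Qed.

(** The core property approximates [u] and [v] in graph norm, and density of [E1] and [E2] in [H]
    gives [p] and [q]. With four errors below e / 4, twice [qsum] stays below e^2 / 2. *)
Lemma energy_dense U (e : R) : X U -> 0 < e -> exists W, [/\ X W, DA W & N (U - W) < e].
Proof.
move=> XU e0; have e4 : 0 < e / 4 by lra.
have [u [Du _ hu]] := sqrt_core _ hip_ok _ _ _ _ hA1 hS1 _ _ XU.1 e4.
have [v [Dv _ hv]] := sqrt_core _ hip_ok _ _ _ _ hA2 hS2 _ _ XU.2 e4.
have [p Ep hp] := sa_dense _ _ _ sa1 (s_p U) _ e4.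
have [q Eq hq] := sa_dense _ _ _ sa2 (s_q U) _ e4.
have XW : X (MkSt u p v q) by split; [exact: sqrt_dom hS1 _ Du|exact: sqrt_dom hS2 _ Dv].
exists (MkSt u p v q); split => //.
have Xn := lsubB _ energy_lsubspace _ _ XU XW.
rewrite -ltr_sqr ?nnegrE ?snorm_ge0 ?(ltW e0) //.
apply: le_lt_trans (energy_le _ Xn) _; rewrite /qsum /=.
have sq (x : R) : 0 <= x -> x < e / 4 -> x ^+ 2 < (e / 4) ^+ 2.
  by move=> x0 xe; rewrite ltr_sqr ?nnegrE // ltW.
have := sq _ (normr_ge0 _) hu; have := sq _ (normr_ge0 _) hv.
have := sq _ (normr_ge0 _) hp; have := sq _ (normr_ge0 _) hq; nra.
Qed.

(** The stiffness terms cancel in pairs, and so do the coupling terms; only the damping remains. *)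
Lemma dissipation U : DA U -> b (G U) U = - ip (B (s_p U)) (s_p U).
Proof.
move=> [Du [Ep [Dv Eq]]]; rewrite /hip /=.
rewrite !(ipDl _ hip_ok, ipNl _ hip_ok, ipZl _ hip_ok).
rewrite (sqrt_form _ _ _ _ _ hS1) // (sqrt_form _ _ _ _ _ hS2) //.
rewrite (ipC _ hip_ok (S1 (s_p U))) (ipC _ hip_ok (S2 (s_q U))).
rewrite (ipC _ hip_ok (s_p U) (s_v U)) (ipC _ hip_ok (s_q U) (s_u U)); ring.
Qed.

End EnergySpace.

(** * The multiplier method *)

Section Young.
Context {R : realType}.
Implicit Types a w k r m : R.

(** The share 1/16 allows five such terms to be absorbed while half of a^2 w^2 survives. *)
Lemma young16 a w k r : a * (k * r * w) <= a ^+ 2 * w ^+ 2 / 16 + 4 * k ^+ 2 * r ^+ 2.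
Proof. by have := sqr_ge0 (a * w / 4 - 2 * k * r); lra. Qed.

(** Here [w] stands for the norm of A_1^{1/2} u'; its square has coefficient 1, to be exchanged once
    by the identity for it. *)
Lemma young4 a k r w : a * (a * (w * (k * r))) <= w ^+ 2 + a ^+ 4 * k ^+ 2 * r ^+ 2.
Proof.
have := sqr_ge0 (w - a ^+ 2 * k * r / 2); have := sqr_ge0 (a ^+ 2 * k * r); lra.
Qed.

Lemma young2 m r w : 0 <= m -> m * r * w <= m * (r ^+ 2 + w ^+ 2).
Proof.
move=> m0; rewrite -mulrA; apply: ler_wpM2l => //.
have := sqr_ge0 (r - w); have := sqr_ge0 r; have := sqr_ge0 w; lra.
Qed.

(** Puts under one constant the remainders left by Young's inequality, grouped as they occur in
    [multiplier_estimate]. *)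
Lemma absorb (k0 k1 k2 k3 k4 k5 k6 p0 p1 p2 p3 p4 : R) :
  0 <= k0 -> 0 <= k1 -> 0 <= k2 -> 0 <= k3 -> 0 <= k4 -> 0 <= k5 -> 0 <= k6 ->
  0 <= p0 -> 0 <= p1 -> 0 <= p2 -> 0 <= p3 -> 0 <= p4 ->
  k0 * (p0 + p1 + p2 + p3) + k1 * p1 + k2 * p3 + k3 * (p3 + p2) + k4 * p4
    + k5 * (p1 + p0) + k6 * p0
  <= (k0 + k1 + k2 + k3 + k4 + k5 + k6) * (p0 + p1 + p2 + p3 + p4).
Proof.
move=> k00 k10 k20 k30 k40 k50 k60 p00 p10 p20 p30 p40; rewrite !mulrDl.
have le (p q k : R) : 0 <= k -> p <= q -> k * p <= k * q.
  by move=> kp pq; exact: ler_wpM2l.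
do ![apply: lerD]; apply: le => //; clear -p00 p10 p20 p30 p40; lra.
Qed.

Lemma sqr_leD (x y z : R) : 0 <= x -> x <= y + z -> x ^+ 2 <= 2 * y ^+ 2 + 2 * z ^+ 2.
Proof.
move=> x0 h; have h1 : x ^+ 2 <= (y + z) ^+ 2 by rewrite ler_sqr ?nnegrE //; lra.
by have := sqr_ge0 (y - z); lra.
Qed.
End Young.

(* [w = |v'|], [r_k = |u^(k+1)|], [s1] and [s3] are the norms of [A_1^{1/2} u'] and
   [A_1^{1/2} u'''], and the [F_i] are time derivatives of bilinear functionals. Young's
   inequality absorbs the products with [w] into [w ^+ 2], and those with [s1], [s3] into the
   exact identities for their squares. *)
Lemma multiplier_estimate (R : realType) (al M K c N w s1 s3 r0 r1 r2 r3 r4 : R)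
    (F1 F2 F3 F4 F5 X0 X1 X2 X3 X4 X5 X6 X7 X8 : R) :
  al != 0 -> 0 <= M -> 0 <= c ->
  `|X0| <= M * r0 * (K * N) -> `|X1| <= r2 * w -> `|X2| <= M * r1 * w ->
  `|X3| <= s3 * (c * w) -> `|X4| <= s1 * (c * r0) -> `|X5| <= M * r3 * r2 ->
  `|X6| <= w * r4 -> `|X7| <= M * r1 * r0 -> `|X8| <= w * r0 ->
  N ^+ 2 = - F1 + 2 * r0 ^+ 2 + 2 * w ^+ 2 - X0 ->
  al * w ^+ 2 = - X1 - X2 + F2 + X3 + al * X4 ->
  s3 ^+ 2 = - F3 - al * F4 + r3 ^+ 2 - X5 - al * X6 ->
  s1 ^+ 2 = - F5 + r1 ^+ 2 - X7 - al * X8 ->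
  N ^+ 2 <= - 2 * F1 + 8 / al ^+ 2 *
      (al * F2 - 4 * c ^+ 2 * F3 - 4 * c ^+ 2 * al * F4 - F5) +
    (8 / al ^+ 2 * (4 + 4 * M ^+ 2 + 4 * c ^+ 2 + 4 * c ^+ 2 * M + 64 * c ^+ 4 + M
       + al ^+ 4 * c ^+ 2) + (4 + M ^+ 2 * K ^+ 2))
    * (r0 ^+ 2 + r1 ^+ 2 + r2 ^+ 2 + r3 ^+ 2 + r4 ^+ 2).
Proof.
move=> al0 M0 c0 h0 h1 h2 h3 h4 h5 h6 h7 h8 eN ew e3 e1.
set a := `|al|; have a0 : 0 <= a by exact: normr_ge0.
have a2 : a ^+ 2 = al ^+ 2 by rewrite real_normK // num_real.
have a4 : a ^+ 4 = al ^+ 4 by rewrite -[4%N]/(2 * 2)%N !exprM a2.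
have sq0 (x : R) := sqr_ge0 x.
have pw4 (x : R) : 0 <= x ^+ 4 by rewrite -[4%N]/(2 * 2)%N exprM.
have up (x y : R) : `|x| <= y -> al * x <= a * y.
  by move=> h; apply: le_trans (ler_norm _) _; rewrite normrM ler_wpM2l.
have dn (x y : R) : `|x| <= y -> - (al * x) <= a * y.
  by move=> h; rewrite -mulrN; apply: up; rewrite normrN.
have neg (x y : R) : `|x| <= y -> - x <= y.
  by move=> h; apply: le_trans h; rewrite -normrN ler_norm.
set P := r0 ^+ 2 + _ + _ + _ + _.
set Phi := al * F2 - _ - _ - _.
set C' := 4 + _ + _ + _ + _ + _ + _.
have c20 : 0 <= 4 * c ^+ 2 by rewrite mulr_ge0.
(* The identity for w^2 is multiplied by [al]; the squares of [s3] and [s1] that Young's inequality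
   produces are then exchanged by means of [e3] and [e1]. *)
have key : a ^+ 2 * w ^+ 2 / 2 <= Phi + C' * P.
  have g1 : - (al * X1) <= a ^+ 2 * w ^+ 2 / 16 + 4 * r2 ^+ 2.
    apply: le_trans (dn _ _ h1) _.
    by have := young16 a w 1 r2; rewrite mul1r expr1n mulr1.
  have g2 : - (al * X2) <= a ^+ 2 * w ^+ 2 / 16 + 4 * M ^+ 2 * r1 ^+ 2.
    by apply: le_trans (dn _ _ h2) _; exact: young16.
  have g3 : al * X3 <= a ^+ 2 * w ^+ 2 / 16 + 4 * c ^+ 2 * s3 ^+ 2.
    by apply: le_trans (up _ _ h3) _; rewrite mulrA [s3 * c]mulrC; exact: young16.
  have g4 : al * (al * X4) <= s1 ^+ 2 + al ^+ 4 * c ^+ 2 * r0 ^+ 2.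
    rewrite -a4; apply: le_trans (young4 a c r0 s1).
    rewrite [X in X <= _]mulrA -expr2 -a2 expr2 -mulrA; apply: ler_wpM2l => //.
    apply: ler_wpM2l => //; exact: le_trans (ler_norm _) h4.
  have g5 : 4 * c ^+ 2 * (- X5) <= 4 * c ^+ 2 * M * (r3 ^+ 2 + r2 ^+ 2).
    rewrite -[in leRHS]mulrA; apply: ler_wpM2l => //.
    by apply: le_trans (neg _ _ h5) _; exact: young2.
  have g6 : 4 * c ^+ 2 * (- (al * X6)) <= a ^+ 2 * w ^+ 2 / 16 + 64 * c ^+ 4 * r4 ^+ 2.
    apply: le_trans (ler_wpM2l c20 (dn _ _ h6)) _.
    have := young16 a w (4 * c ^+ 2) r4.
    have -> : 4 * (4 * c ^+ 2) ^+ 2 * r4 ^+ 2 = 64 * c ^+ 4 * r4 ^+ 2 by ring.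
    by have -> : a * (4 * c ^+ 2 * r4 * w) = 4 * c ^+ 2 * (a * (w * r4)) by ring.
  have g7 : - X7 <= M * (r1 ^+ 2 + r0 ^+ 2).
    by apply: le_trans (neg _ _ h7) _; exact: young2.
  have g8 : - (al * X8) <= a ^+ 2 * w ^+ 2 / 16 + 4 * r0 ^+ 2.
    apply: le_trans (dn _ _ h8) _.
    by have := young16 a w 1 r0; rewrite mul1r expr1n mulr1 [r0 * w]mulrC.
  have ew' : a ^+ 2 * w ^+ 2 =
      - (al * X1) - al * X2 + al * F2 + al * X3 + al * (al * X4).
    by rewrite a2 expr2 -[LHS]mulrA ew; ring.
  have e3' : 4 * c ^+ 2 * s3 ^+ 2 = - (4 * c ^+ 2 * F3) - 4 * c ^+ 2 * al * F4
      + 4 * c ^+ 2 * r3 ^+ 2 + 4 * c ^+ 2 * (- X5) + 4 * c ^+ 2 * (- (al * X6)).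
    by rewrite e3; ring.
  have yy : 0 <= a ^+ 2 * w ^+ 2 by rewrite mulr_ge0.
  have nn3 : 0 <= 4 * c ^+ 2 * M by rewrite mulr_ge0.
  have nn5 : 0 <= al ^+ 4 * c ^+ 2 by rewrite mulr_ge0.
  have nn1 : 0 <= 4 * M ^+ 2 by rewrite mulr_ge0.
  have nn4 : 0 <= 64 * c ^+ 4 by rewrite mulr_ge0.
  have := absorb _ _ _ _ _ _ _ _ _ _ _ _ (ler0n R 4) nn1 c20 nn3 nn4 M0 nn5
    (sq0 r0) (sq0 r1) (sq0 r2) (sq0 r3) (sq0 r4).
  rewrite -/C' -/P.
  move: (sq0 r0) (sq0 r1) (sq0 r2) (sq0 r3).
  rewrite /Phi; clear -g1 g2 g3 g4 g5 g6 g7 g8 ew' e3' e1 yy.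
  move: (C' * P) (a ^+ 2 * w ^+ 2) g1 g2 g3 g4 g5 g6 g7 g8 ew' e3' e1 yy => Z Y.
  move: (4 * c ^+ 2 * (- (al * X6))) (4 * c ^+ 2 * (- X5)) (4 * c ^+ 2 * s3 ^+ 2).
  move: (al * X1) (al * X2) (al * X3) (al * (al * X4)) (al * X8) => ? ? ? ? ? ? ? ?.
  move: (4 * c ^+ 2 * M) (4 * c ^+ 2 * r3 ^+ 2) (4 * M ^+ 2 * r1 ^+ 2) => ? ? ?.
  move: (al ^+ 4 * c ^+ 2 * r0 ^+ 2) (64 * c ^+ 4 * r4 ^+ 2) => ? ?.
  move: (4 * c ^+ 2 * F3) (4 * c ^+ 2 * al * F4) (al * F2) => ? ? ?.
  by move: (r0 ^+ 2) (r1 ^+ 2) (r2 ^+ 2) (r3 ^+ 2) (s1 ^+ 2) => ? ? ? ? ?; lra.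
(* The square of N - M K r0 absorbs [X0] into half of N^2, whence the doubled coefficients. *)
have N2 : N ^+ 2 <= - 2 * F1 + 4 * w ^+ 2 + (4 + M ^+ 2 * K ^+ 2) * r0 ^+ 2.
  have := neg _ _ h0; move: eN; have := sq0 (N - M * K * r0); clear.
  lra.
have al2 : 0 < al ^+ 2 by rewrite exprn_even_gt0.
have w4 : 4 * w ^+ 2 <= 8 / al ^+ 2 * (Phi + C' * P).
  have -> : 4 * w ^+ 2 = 8 / al ^+ 2 * (a ^+ 2 * w ^+ 2 / 2).
    by rewrite a2; field.
  by apply: ler_wpM2l => //; rewrite divr_ge0 // ltW.
have MK : 0 <= 4 + M ^+ 2 * K ^+ 2 by rewrite addr_ge0 // mulr_ge0.
have r0P : r0 ^+ 2 <= P.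
  by rewrite /P -!addrA lerDl !addr_ge0.
have := ler_wpM2l MK r0P; move: N2 w4; clear; clearbody P Phi C'.
move: (8 / al ^+ 2) (4 + M ^+ 2 * K ^+ 2) (r0 ^+ 2) (w ^+ 2) (N ^+ 2); clear => *; lra.
Qed.

(** * The semigroup of the coupled system *)

Section Decay.
Context {R : realType} {H : completeNormedModType R}.
Variables (ip : H -> H -> R) (hip_ok : is_inner ip).
Variables (D1 : set H) (A1 : H -> H) (D2 : set H) (A2 : H -> H).
Variables (E1 : set H) (S1 : H -> H) (E2 : set H) (S2 : H -> H).
Variables (B : H -> H) (omega1 omega2 beta alpha : R).
Hypotheses (hA1 : self_adjoint ip D1 A1) (hA2 : self_adjoint ip D2 A2).
Hypotheses (hom1 : 0 < omega1) (hom2 : 0 < omega2).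
Hypotheses (hA1c : forall u, D1 u -> ip (A1 u) u >= omega1 * `|u| ^+ 2).
Hypotheses (hA2c : forall u, D2 u -> ip (A2 u) u >= omega2 * `|u| ^+ 2).
Hypotheses (hS1 : is_sqrt_op ip D1 A1 E1 S1) (hS2 : is_sqrt_op ip D2 A2 E2 S2).
Hypotheses (hB : bounded_sa ip B) (hbeta : 0 < beta).
Hypothesis hBc : forall u, ip (B u) u >= beta * `|u| ^+ 2.
Hypothesis halpha : 0 < `|alpha| < Num.sqrt (omega1 * omega2).
Variable T : R -> St H -> St H.
Hypothesis hT : generates (inHH E1 E2) (hnorm ip S1 S2 alpha) (DAA D1 E1 D2 E2)
          (AA A1 A2 B alpha) T.
Hypothesis hD21 : D2 `<=` E1.
Variable c : R.
Hypotheses (hc : 0 < c) (hcc : forall u, D2 u -> `|S1 u| <= c * `|A2 u|).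

Local Notation X := (inHH E1 E2).
Local Notation b := (hip ip S1 S2 alpha).
Local Notation N := (snorm b).
Local Notation DA := (DAA D1 E1 D2 E2).
Local Notation G := (AA A1 A2 B alpha).
Let sa1 := sqrt_sa _ _ _ _ _ hS1.
Let sa2 := sqrt_sa _ _ _ _ _ hS2.
Let hb : semi_inner X b := energy_semi_inner _ hip_ok _ _ _ _ _ _ _ _ _ _ _
  hA1 hA2 hom1 hom2 hA1c hA2c hS1 hS2 halpha.
Let cX : scomplete X b := energy_scomplete _ hip_ok _ _ _ _ _ _ _ _ _ _ _
  hA1 hA2 hom1 hom2 hA1c hA2c hS1 hS2 halpha.
Let sX := si_sub _ _ hb.

Lemma generates_semigroup : c0_semigroup X b T.
Proof.
case: hT => [h1 [h2 [h3 [h4 [h5 [h6 _]]]]]].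
apply: C0Semigroup => [t t0|t t0|u Xu|s t u|u Xu e /(h6 u Xu)[d [d0 hd]]].
- by split; [move=> u; exact: h1|move=> a u v; exact: h2].
- exact: h3.
- exact: h4.
- exact: h5.
- by exists d => // h hh0 hhd; rewrite -st_subE; exact: hd.
Qed.
Let sT := generates_semigroup.

Lemma gen_atP U W : X U -> X W -> (DA U /\ G U = W) <-> gen_at b T U W.
Proof.
move=> XU XW; case: hT => [_ [_ [_ [_ [_ [_ [_ /(_ U W XU XW)h]]]]]]].
rewrite h; split.
  move=> q; apply/cvg_right0P => e /q [d [d0 hd]]; exists d => // t t0 td.
  by rewrite subr0 ger0_norm ?snorm_ge0 //; have := hd t t0 td; rewrite !st_subE.
move=> /cvg_right0P q e /q [d d0 hd]; exists d; split => // t t0 td.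
by have := hd t t0 td; rewrite subr0 ger0_norm ?snorm_ge0 // !st_subE.
Qed.

Lemma domX U : DA U -> X U.
Proof.
move=> [Du [_ [Dv _]]]; split; [exact: sqrt_dom hS1 _ Du|exact: sqrt_dom hS2 _ Dv].
Qed.
Lemma genX U : DA U -> X (G U).
Proof. by move=> [_ [Ep [_ Eq]]]. Qed.
Lemma gen_at_dom U : DA U -> gen_at b T U (G U).
Proof. by move=> DU; apply/gen_atP => //; [exact: domX|exact: genX]. Qed.

Lemma damping U : DA U -> b (G U) U <= - beta * `|s_p U| ^+ 2.
Proof.
by move=> DU; rewrite (dissipation _ hip_ok _ _ _ _ _ _ _ _ _ _ hS1 hS2) // mulNr lerN2.
Qed.

Lemma energy_decreasing t U : 0 <= t -> X U -> N (T t U) <= N U.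
Proof.
move=> t0 XU0; apply: (dissipative_contraction _ _ hb T sT cX _ _ t U t0 XU0) => {t U t0 XU0}.
  move=> U W XU XW /(gen_atP _ _ XU XW)[DU <-]; apply: le_trans (damping _ DU) _.
  by rewrite mulNr oppr_le0 mulr_ge0 ?sqr_ge0 // ltW.
move=> U XU e e0.
have [W [XW DW UW]] := energy_dense _ hip_ok _ _ _ _ _ _ _ _ _ _ _
  hA1 hA2 hom1 hom2 hA1c hA2c hS1 hS2 halpha _ _ XU e0.
by exists W, (G W); split => //; [exact: genX|exact: gen_at_dom].
Qed.

Lemma T_dom t U : 0 <= t -> DA U -> DA (T t U) /\ G (T t U) = T t (G U).
Proof.
move=> t0 DU; have XU := domX _ DU; have XG := genX _ DU.
apply/gen_atP; [exact: sgX sT _ _ t0 XU|exact: sgX sT _ _ t0 XG|].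
by apply: (gen_at_T _ _ hb _ sT) => //; exact: gen_at_dom.
Qed.

(** The inverse of [A2], obtained by choice: coercivity makes [A2] surjective and injective, and
    linearity follows from injectivity. *)
Lemma inverse_exists : exists J : H -> H,
  [/\ forall f, D2 (J f), forall f, A2 (J f) = f, forall v, D2 v -> J (A2 v) = v &
      forall (a : R) f g, J (a *: f + g) = a *: J f + J g].
Proof.
have sub2 := sa_sub _ _ _ hA2.
have /choice [J hJ] : forall f, exists z, D2 z /\ A2 z = f.
  by move=> f; have [z ? ?] := coercive_surjective _ hip_ok _ _ hA2 _ hom2 hA2c f; exists z.
have inj u v : D2 u -> D2 v -> A2 u = A2 v -> u = v.
  move=> Du Dv e; have := hA2c _ (lsubB _ sub2 _ _ Du Dv).
  rewrite (sa_B _ _ _ hA2) // e subrr (ipC _ hip_ok) -(scale0r (u - v)) (ipZr _ hip_ok).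
  rewrite mul0r pmulr_rle0 // => h.
  have : `|u - v| ^+ 2 == 0 by rewrite eq_le h sqr_ge0.
  by rewrite sqrf_eq0 normr_eq0 subr_eq0 => /eqP.
have DJ f : D2 (J f) by case: (hJ f).
have AJ f : A2 (J f) = f by case: (hJ f).
exists J; split => //.
- by move=> v Dv; apply: inj.
- move=> a f g; apply: inj => //; first exact: lsubL sub2 _ _ _ (DJ f) (DJ g).
  by rewrite AJ (sa_lin _ _ _ hA2) // !AJ.
Qed.

Section Multipliers.
Variable J : H -> H.
Hypotheses (JD : forall f, D2 (J f)) (AJ : forall f, A2 (J f) = f).
Hypothesis JA : forall v, D2 v -> J (A2 v) = v.
Hypothesis Jlin : forall (a : R) f g, J (a *: f + g) = a *: J f + J g.

(** The functionals of the multiplier method, with two arguments so that different time derivatives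
    of an orbit can be paired; [fJ] pairs A_1^{1/2} u with A_1^{1/2} A_2^{-1} v. *)
Definition fup (U W : St H) := ip (s_u U) (s_p W).
Definition fvq (U W : St H) := ip (s_v U) (s_q W).
Definition fvu (U W : St H) := ip (s_v U) (s_u W).
Definition fvp (U W : St H) := ip (s_v U) (s_p W).
Definition fJ (U W : St H) := ip (S1 (s_u U)) (S1 (J (s_v W))).

Lemma S1J_bound f : `|S1 (J f)| <= c * `|f|.
Proof. by rewrite -[in leRHS](AJ f); exact: hcc. Qed.

Lemma S1J_lin (a : R) f g : S1 (J (a *: f + g)) = a *: S1 (J f) + S1 (J g).
Proof. by rewrite Jlin (sa_lin _ _ _ sa1) //; exact: hD21. Qed.

(** [Z0], ..., [Z4] stand for successive time derivatives of an orbit at one instant: [s_p Z0] is u'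
    and [s_v Z1] is v'. Each sum f Z_{i+1} Z_j + f Z_i Z_{j+1} is the derivative of f Z_i Z_j. *)
Lemma pointwise_estimate : exists2 C : R, 0 <= C & forall Z0 Z1 Z2 Z3 Z4,
  [/\ DA Z0, DA Z1, DA Z2 & DA Z3] ->
  [/\ G Z0 = Z1, G Z1 = Z2, G Z2 = Z3 & G Z3 = Z4] ->
  N Z0 ^+ 2 <=
    - 2 * ((fup Z1 Z0 + fup Z0 Z1) + (fvq Z1 Z0 + fvq Z0 Z1)) +
    8 / alpha ^+ 2 *
      (alpha * ((fJ Z2 Z2 + fJ Z1 Z3) - (fJ Z3 Z1 + fJ Z2 Z2))
       - 4 * c ^+ 2 * (fup Z4 Z3 + fup Z3 Z4)
       - 4 * c ^+ 2 * alpha * ((fvu Z3 Z3 + fvu Z2 Z4) - (fvp Z2 Z3 + fvp Z1 Z4))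
       - (fup Z2 Z1 + fup Z1 Z2)) +
    C * (`|s_p Z0| ^+ 2 + `|s_p Z1| ^+ 2 + `|s_p Z2| ^+ 2 + `|s_p Z3| ^+ 2 + `|s_p Z4| ^+ 2).
Proof.
have [_ [[M0 hM0] _]] := hB.
pose M : R := `|M0|; have M_ge0 : 0 <= M by exact: normr_ge0.
have hM u : `|B u| <= M * `|u|.
  by apply: le_trans (hM0 u) _; rewrite ler_wpM2r // ler_norm.
have [_ [K K0 hK]] := blin_u _ hip_ok _ _ _ _ _ _ _ _ _ _ _
  hA1 hA2 hom1 hom2 hA1c hA2c hS1 hS2 halpha.
have al0 : alpha != 0 by rewrite -normr_gt0; case/andP: halpha.
have c_ge0 := ltW hc.
(* The constant is read off from [multiplier_estimate], and its sign is checked at the end. *)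
eexists; last first.
  move=> Z0 Z1 Z2 Z3 Z4 [Z0d Z1d Z2d Z3d] [e1 e2 e3 e4].
  have u1 : s_u Z1 = s_p Z0 by rewrite -e1.
  have u2 : s_u Z2 = s_p Z1 by rewrite -e2.
  have u3 : s_u Z3 = s_p Z2 by rewrite -e3.
  have u4 : s_u Z4 = s_p Z3 by rewrite -e4.
  have v1 : s_v Z1 = s_q Z0 by rewrite -e1.
  have v3 : s_v Z3 = s_q Z2 by rewrite -e3.
  have p1 : s_p Z1 = - A1 (s_u Z0) - B (s_p Z0) - alpha *: s_v Z0 by rewrite -e1.
  have p2 : s_p Z2 = - A1 (s_u Z1) - B (s_p Z1) - alpha *: s_v Z1 by rewrite -e2.
  have p4 : s_p Z4 = - A1 (s_u Z3) - B (s_p Z3) - alpha *: s_v Z3 by rewrite -e4.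
  have q1 : s_q Z1 = - A2 (s_v Z0) - alpha *: s_u Z0 by rewrite -e1.
  have q2 : s_q Z2 = - A2 (s_v Z1) - alpha *: s_u Z1 by rewrite -e2.
  have XZ0 := domX _ Z0d.
  case: Z0d => Du0 [Ep0 [Dv0 Eq0]]; case: Z1d => Du1 [Ep1 [Dv1 Eq1]].
  case: Z3d => Du3 [Ep3 [Dv3 Eq3]].
  have E1u Z : D1 (s_u Z) -> E1 (s_u Z) by exact: sqrt_dom hS1 _.
  have E2v Z : D2 (s_v Z) -> E2 (s_v Z) by exact: sqrt_dom hS2 _.
  have CS := ip_CS _ hip_ok.
  have lip u w x y : `|u| <= x -> `|w| <= y -> `|ip u w| <= x * y.
    by move=> hx hy; apply: le_trans (CS u w) _; exact: ler_pM.
  have ipE := (ipDl _ hip_ok, ipDr _ hip_ok, ipNl _ hip_ok, ipNr _ hip_ok,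
               ipZl _ hip_ok, ipZr _ hip_ok).
  apply: (multiplier_estimate R alpha M K c (N Z0) (`|s_v Z1|) (`|S1 (s_u Z1)|)
    (`|S1 (s_u Z3)|) (`|s_p Z0|) (`|s_p Z1|) (`|s_p Z2|) (`|s_p Z3|) (`|s_p Z4|)
    _ _ _ _ _ (ip (B (s_p Z0)) (s_u Z0)) (ip (s_p Z2) (s_v Z1))
    (ip (B (s_p Z1)) (s_v Z1)) (fJ Z3 Z1) (ip (S1 (s_u Z1)) (S1 (J (s_u Z1))))
    (ip (B (s_p Z3)) (s_u Z3)) (ip (s_v Z1) (s_p Z4)) (ip (B (s_p Z1)) (s_u Z1))
    (ip (s_v Z1) (s_u Z1))) => //.
  - by apply: lip => //; exact: hK.
  - exact: lip.
  - by apply: lip => //; exact: S1J_bound.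
  - by apply: lip => //; rewrite -u1; exact: S1J_bound.
  - by rewrite u3; apply: lip.
  - by rewrite u1; apply: lip.
  - by rewrite u1; apply: lip.
  (* Equipartition: testing the two equations with u and v trades potential energy for kinetic
     energy. *)
  - rewrite (sqr_snorm _ _ hb) // hip_diag // /qsum /fup /fvq u1 v1 p1 q1.
    rewrite !ipE (ipC _ hip_ok (s_u Z0) (A1 _)) (sqrt_form _ _ _ _ _ hS1) //; last exact: E1u.
    rewrite (ipC _ hip_ok (s_v Z0) (A2 _)) (sqrt_form _ _ _ _ _ hS2) //; last exact: E2v.
    rewrite (ipC _ hip_ok (s_v Z0) (s_u Z0)) (ipC _ hip_ok (s_u Z0) (B _)).
    rewrite !(ip_sqr _ hip_ok); ring.
  (* The second equation, differentiated once and solved for v': v' = - J v''' - alpha J u'. *)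
  - have vJ : s_v Z1 = (- 1) *: J (s_q Z2) + (- alpha) *: J (s_u Z1).
      rewrite -[in LHS](JA _ Dv1) -[(- alpha) *: _]addr0.
      have J0 : J 0 = 0 by have := Jlin 1 0 0; rewrite !scale1r addr0 => /eqP;
        rewrite -subr_eq0 opprD addrA subrr sub0r oppr_eq0 => /eqP.
      rewrite -J0 -!Jlin; congr J; rewrite q2 addr0 scaleN1r opprB opprK scaleNr.
      by rewrite addrC addKr.
    have sJ : S1 (s_v Z1) = (- 1) *: S1 (J (s_q Z2)) + (- alpha) *: S1 (J (s_u Z1)).
      rewrite {1}vJ (sa_lin _ _ _ sa1); [|exact: hD21|].
        congr (_ + _); rewrite -[(- alpha) *: J _]addr0.
        rewrite (sa_lin _ _ _ sa1); [|exact: hD21|exact: lsub0 (sa_sub _ _ _ sa1)].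
        have -> : S1 0 = 0.
          have := sa_B _ _ _ sa1 _ _ (hD21 _ Dv1) (hD21 _ Dv1); by rewrite !subrr.
        by rewrite addr0.
      by apply: (lsubZ _ (sa_sub _ _ _ sa1)); exact: hD21.
    (* The differentiated first equation tested with v', the source of alpha |v'|^2. *)
    have h2 : ip (s_p Z2) (s_v Z1) = - ip (S1 (s_u Z1)) (S1 (s_v Z1))
       - ip (B (s_p Z1)) (s_v Z1) - alpha * `|s_v Z1| ^+ 2.
      by rewrite p2 !ipE (sqrt_form _ _ _ _ _ hS1) ?(ip_sqr _ hip_ok) //; exact: hD21.
    (* The two copies of [fJ Z2 Z2] cancel, which is the double integration by parts turning
       [fJ Z1 Z3] into [fJ Z3 Z1]. *)
    move: h2; rewrite sJ !ipE /fJ v3 => h2; lra.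
  (* Integrating by parts twice also turns the coupling term <v''', u'''> into <v', u^(5)>, where
     only v' remains of v. *)
  - rewrite -(ip_sqr _ hip_ok) -(ip_sqr _ hip_ok (s_p Z3)) /fup /fvu /fvp u4.
    have -> : ip (s_u Z3) (s_p Z4) = - ip (S1 (s_u Z3)) (S1 (s_u Z3))
       - ip (B (s_p Z3)) (s_u Z3) - alpha * ip (s_v Z3) (s_u Z3).
      rewrite (ipC _ hip_ok) p4 !ipE (sqrt_form _ _ _ _ _ hS1) //; exact: E1u.
    ring.
  - rewrite -(ip_sqr _ hip_ok) -(ip_sqr _ hip_ok (s_p Z1)) /fup u2.
    have -> : ip (s_u Z1) (s_p Z2) = - ip (S1 (s_u Z1)) (S1 (s_u Z1))
       - ip (B (s_p Z1)) (s_u Z1) - alpha * ip (s_v Z1) (s_u Z1).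
      rewrite (ipC _ hip_ok) p2 !ipE (sqrt_form _ _ _ _ _ hS1) //; exact: E1u.
    ring.
have al2 : 0 <= alpha ^+ 2 by exact: sqr_ge0.
have al4 : 0 <= alpha ^+ 4 by rewrite -[4%N]/(2 * 2)%N exprM sqr_ge0.
have c4 : 0 <= c ^+ 4 by exact: exprn_ge0.
have c2 := sqr_ge0 c; have M2 := sqr_ge0 M; have K2 := sqr_ge0 K.
by repeat first [done | exact: ler0n | apply: addr_ge0 | apply: mulr_ge0 | rewrite invr_ge0].
Qed.

Let bu : blin ip E1 S1 E2 S2 alpha (@s_u H) := blin_u _ hip_ok _ _ _ _ _ _ _ _ _ _ _
  hA1 hA2 hom1 hom2 hA1c hA2c hS1 hS2 halpha.
Let bv : blin ip E1 S1 E2 S2 alpha (@s_v H) := blin_v _ hip_ok _ _ _ _ _ _ _ _ _ _ _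
  hA1 hA2 hom1 hom2 hA1c hA2c hS1 hS2 halpha.
Let bp : blin ip E1 S1 E2 S2 alpha (@s_p H) := blin_p _ hip_ok _ _ _ _ _ _ _ _ _ _ _
  hA1 hA2 hom1 hom2 hA1c hA2c hS1 hS2 halpha.
Let bq : blin ip E1 S1 E2 S2 alpha (@s_q H) := blin_q _ hip_ok _ _ _ _ _ _ _ _ _ _ _
  hA1 hA2 hom1 hom2 hA1c hA2c hS1 hS2 halpha.
Let bSu : blin ip E1 S1 E2 S2 alpha (S1 \o @s_u H) := blin_S1u _ hip_ok _ _ _ _ _ _ _ _ _ _ _
  hA1 hA2 hom1 hom2 hA1c hA2c hS1 hS2 halpha.

Lemma bform_fup : bform X b fup. Proof. exact: (bform_ip _ hip_ok _ _ _ _ _ _ _ bu bp). Qed.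
Lemma bform_fvq : bform X b fvq. Proof. exact: (bform_ip _ hip_ok _ _ _ _ _ _ _ bv bq). Qed.
Lemma bform_fvu : bform X b fvu. Proof. exact: (bform_ip _ hip_ok _ _ _ _ _ _ _ bv bu). Qed.
Lemma bform_fvp : bform X b fvp. Proof. exact: (bform_ip _ hip_ok _ _ _ _ _ _ _ bv bp). Qed.
Lemma bform_fJ : bform X b fJ.
Proof.
apply: (bform_ip _ hip_ok _ _ _ _ _ (S1 \o @s_u H) ((S1 \o J) \o @s_v H) bSu).
exact: (blin_post _ _ _ _ _ _ _ (S1 \o J) _ bv S1J_lin S1J_bound).
Qed.

(** * The Lyapunov functional *)

Definition sum5 (Z : nat -> St H) : R :=
  N (Z 0) ^+ 2 + N (Z 1) ^+ 2 + N (Z 2) ^+ 2 + N (Z 3) ^+ 2 + N (Z 4) ^+ 2.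

Definition quad_bounded (L : (nat -> St H) -> R) : Prop :=
  exists2 C : R, 0 <= C & forall Z, (forall i, X (Z i)) -> `|L Z| <= C * sum5 Z.

Lemma quad_boundedD L M : quad_bounded L -> quad_bounded M ->
  quad_bounded (fun Z => L Z + M Z).
Proof.
move=> [C C0 hC] [C' C'0 hC']; exists (C + C'); first exact: addr_ge0.
move=> Z XZ; apply: le_trans (ler_normD _ _) _; rewrite mulrDl.
by apply: lerD; [exact: hC|exact: hC'].
Qed.

Lemma quad_boundedZ a L : quad_bounded L -> quad_bounded (fun Z => a * L Z).
Proof.
move=> [C C0 hC]; exists (`|a| * C); first exact: mulr_ge0.
by move=> Z XZ; rewrite normrM -mulrA ler_wpM2l //; exact: hC.
Qed.

Lemma quad_bounded_form f i j : bform X b f -> (i < 5)%N -> (j < 5)%N ->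
  quad_bounded (fun Z => f (Z i) (Z j)).
Proof.
move=> /bform_bound [C C0 hC] i5 j5; exists (2 * C); first by rewrite mulr_ge0.
move=> Z XZ; apply: le_trans (hC _ _ (XZ i) (XZ j)) _.
have le k : (k < 5)%N -> N (Z k) ^+ 2 <= sum5 Z.
  rewrite /sum5 => k5.
  have := sqr_ge0 (N (Z 0)); have := sqr_ge0 (N (Z 1)); have := sqr_ge0 (N (Z 2)).
  have := sqr_ge0 (N (Z 3)); have := sqr_ge0 (N (Z 4));
  move: k5; do 5?[case: k => [|k]]; rewrite ?ltnS ?ltn0 // => *; lra.
rewrite [2 * C]mulrC -mulrA; apply: ler_wpM2l => //.
have := le i i5; have := le j j5; lra.
Qed.

(** Antiderivatives of the derivative terms of [pointwise_estimate], with opposite sign, plus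
    energies whose dissipation pays for the velocities. The last energy has weight 2, since passing
    from G^4 U to an approximation doubles the square of its velocity. Differences are written with
    (-1) to match [rdiffD] and [rdiffZ]. *)
Definition lyapunov (k m : R) (Z : nat -> St H) : R :=
  2 * (fup (Z 0) (Z 0) + fvq (Z 0) (Z 0))
  + (- k * alpha * (fJ (Z 1) (Z 2) + (-1) * fJ (Z 2) (Z 1))
  + (4 * k * c ^+ 2 * fup (Z 3) (Z 3)
  + (4 * k * c ^+ 2 * alpha * (fvu (Z 2) (Z 3) + (-1) * fvp (Z 1) (Z 3))
  + (k * fup (Z 1) (Z 1)
  + m * (b (Z 0) (Z 0) + (b (Z 1) (Z 1) + (b (Z 2) (Z 2) + (b (Z 3) (Z 3)
       + 2 * b (Z 4) (Z 4))))))))).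

Lemma lyapunov_bounded k m : quad_bounded (lyapunov k m).
Proof.
have fb := bform_inner _ _ hb; have f1 := bform_fup; have f2 := bform_fvq.
have f3 := bform_fvu; have f4 := bform_fvp; have f5 := bform_fJ.
rewrite /lyapunov.
have qf f i j hf i5 j5 := quad_bounded_form f i j hf i5 j5.
by repeat first [exact: (qf fup 0 0 f1)%N | exact: (qf fvq 0 0 f2)%N
  | exact: (qf fJ 1 2 f5)%N | exact: (qf fJ 2 1 f5)%N | exact: (qf fup 3 3 f1)%N
  | exact: (qf fvu 2 3 f3)%N | exact: (qf fvp 1 3 f4)%N | exact: (qf fup 1 1 f1)%N
  | exact: (qf b 0 0 fb)%N | exact: (qf b 1 1 fb)%N | exact: (qf b 2 2 fb)%N
  | exact: (qf b 3 3 fb)%N | exact: (qf b 4 4 fb)%N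
  | apply: quad_boundedD | apply: quad_boundedZ].
Qed.

Let DAkS k U : DAk D1 E1 D2 E2 A1 A2 B alpha k.+1 U ->
  DA U /\ DAk D1 E1 D2 E2 A1 A2 B alpha k (G U).
Proof. by []. Qed.

(* [W] stands in for [G^4 U], which need not lie in the domain of the generator. *)
Lemma lyapunov_decay : exists C1 C2 : R, [/\ 0 <= C1, 0 <= C2 &
  forall U W, DAk D1 E1 D2 E2 A1 A2 B alpha 4 U -> DA W -> forall t, 0 <= t ->
    t * N (T t U) ^+ 2 <=
      C1 * (N U ^+ 2 + N (G U) ^+ 2 + N (G (G U)) ^+ 2 + N (G (G (G U))) ^+ 2 + N W ^+ 2)
      + t * (C2 * N (G (G (G (G U))) - W) ^+ 2)].
Proof.
have [C C0 hC] := pointwise_estimate.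
have [plin [K K0 hK]] := bp.
pose k : R := 8 / alpha ^+ 2.
(* An energy has derivative at most - 2 beta |p|^2, so [m] of it pays for C |p|^2. *)
pose m : R := C / (2 * beta).
have m0 : 0 <= m by rewrite divr_ge0 // mulr_ge0 // ltW.
have [C1 C10 hC1] := lyapunov_bounded k m.
exists (2 * C1), (2 * C * K ^+ 2); split.
- by rewrite mulr_ge0.
- by apply: mulr_ge0; [rewrite mulr_ge0|exact: sqr_ge0].
move=> U W /DAkS[d0 /DAkS[d1 /DAkS[d2 /DAkS[d3 X4]]]] dW t t0.
have XW := domX _ dW.
set U1 := G U in d1 d2 d3 X4 *; set U2 := G U1 in d2 d3 X4 *.
set U3 := G U2 in d3 X4 *; set U4 := G U3 in X4 *.
pose Y i := nth W [:: U; U1; U2; U3] i.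
have dY i : DA (Y i) by case: i => [|[|[|[|[|i]]]]].
have XY i : X (Y i) by exact: domX.
have orb f i j (hf : bform X b f) := rdiff_orbit _ _ hb T sT cX f (Y i) (G (Y i)) (Y j)
  (G (Y j)) hf (XY i) (genX _ (dY i)) (XY j) (genX _ (dY j))
  (gen_at_dom _ (dY i)) (gen_at_dom _ (dY j)).
set E := N (T t U) ^+ 2; set d := N (U4 - W).
(* [E] is the energy at the final time, hence a lower bound for the energy at earlier times; the
   subtracted term is the price of replacing [U4] by [W]. *)
pose a : R := E - 2 * C * K ^+ 2 * d ^+ 2.
have fb := bform_inner _ _ hb.
have D := rdiffD _ _ _ _ (rdiffD _ _ _ _
   (rdiffZ 2 _ _ (rdiffD _ _ _ _ (orb _ 0%N 0%N bform_fup) (orb _ 0%N 0%N bform_fvq)))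
  (rdiffD _ _ _ _
   (rdiffZ (- k * alpha) _ _ (rdiffD _ _ _ _ (orb _ 1%N 2%N bform_fJ)
      (rdiffZ (-1) _ _ (orb _ 2%N 1%N bform_fJ))))
  (rdiffD _ _ _ _ (rdiffZ (4 * k * c ^+ 2) _ _ (orb _ 3%N 3%N bform_fup))
  (rdiffD _ _ _ _ (rdiffZ (4 * k * c ^+ 2 * alpha) _ _ (rdiffD _ _ _ _
     (orb _ 2%N 3%N bform_fvu) (rdiffZ (-1) _ _ (orb _ 1%N 3%N bform_fvp))))
  (rdiffD _ _ _ _ (rdiffZ k _ _ (orb _ 1%N 1%N bform_fup))
  (rdiffZ m _ _ (rdiffD _ _ _ _ (orb _ 0%N 0%N fb) (rdiffD _ _ _ _ (orb _ 1%N 1%N fb)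
    (rdiffD _ _ _ _ (orb _ 2%N 2%N fb) (rdiffD _ _ _ _ (orb _ 3%N 3%N fb)
      (rdiffZ 2 _ _ (orb _ 4%N 4%N fb))))))))))))
  (rdiffM_linear a).
have := rdiff_decr _ _ t D t0.
rewrite -[X in X + t * a]/(lyapunov k m (fun i => T t (Y i))).
rewrite -[X in X + 0 * a]/(lyapunov k m (fun i => T 0 (Y i))).
have -> : (fun i => T 0 (Y i)) = Y by apply/funext => i; exact: (sg_0 _ _ _ sT).
move=> decr.
have {}decr : lyapunov k m (fun i => T t (Y i)) + t * a <= lyapunov k m Y + 0 * a.
  apply: decr => s s0 st.
  have XT V : X V -> X (T s V) by exact: sgX sT _ _ s0.
  have [z0 e0] := T_dom _ _ s0 d0; have [z1 e1] := T_dom _ _ s0 d1.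
  have [z2 e2] := T_dom _ _ s0 d2; have [z3 e3] := T_dom _ _ s0 d3.
  have [zW eW] := T_dom _ _ s0 dW.
  have dmp V V' : DA V -> G V = V' -> m * (b V' V + b V V') <= - C * `|s_p V| ^+ 2.
    move=> DV <-; have h := ler_wpM2l m0 (damping _ DV).
    rewrite (si_sym _ _ hb _ _ (domX _ DV) (genX _ DV)).
    have -> : - C * `|s_p V| ^+ 2 = 2 * (m * (- beta * `|s_p V| ^+ 2)).
      by rewrite /m; field; rewrite gt_eqF.
    by move: h; lra.
  have g0 := dmp _ _ z0 e0; have g1 := dmp _ _ z1 e1; have g2 := dmp _ _ z2 e2.
  have g3 := dmp _ _ z3 e3; have gW := dmp _ _ zW eW.
  have pt := hC _ _ _ _ _ (And4 z0 z1 z2 z3) (And4 e0 e1 e2 e3).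
  (* Contractivity keeps the orbits of [U4] and [W] within distance [d] of each other. *)
  have p4 : `|s_p (T s U4)| ^+ 2 <= 2 * `|s_p (T s W)| ^+ 2 + 2 * (K ^+ 2 * d ^+ 2).
    have h1 := hK _ (lsubB _ sX _ _ (XT _ X4) (XT _ XW)).
    have h2 : N (T s U4 - T s W) <= d.
      rewrite -(lin_onB _ _ hb _ (sg_lin _ _ _ sT s s0)) //.
      by apply: energy_decreasing => //; exact: (lsubB _ sX).
    have h3 := ler_normD (s_p (T s W)) (s_p (T s U4 - T s W)).
    rewrite -[s_p (T s W) + _]/(s_p (T s W + (T s U4 - T s W))) addrC subrK in h3.
    have h4 : `|s_p (T s U4 - T s W)| <= K * d.
      by apply: le_trans h1 _; rewrite ler_pM2l.
    rewrite -exprMn; apply: sqr_leD => //; apply: le_trans h3 _.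
    by rewrite lerD2l.
  have mono : E <= N (T s U) ^+ 2.
    rewrite /E ler_sqr ?nnegrE ?snorm_ge0 //.
    have -> : t = (t - s) + s by rewrite subrK.
    have ts : 0 <= t - s by rewrite subr_ge0 ltW.
    rewrite (sg_add _ _ _ sT) //; last exact: domX.
    by apply: energy_decreasing => //; exact/XT/domX.
  have Cp4 := ler_wpM2l C0 p4.
  move: pt g0 g1 g2 g3 gW Cp4 mono; rewrite /Y /= /a -/k -/U1 -/U2 -/U3 -/U4; lra.
have h1 := hC1 _ XY.
have h2 := hC1 (fun i => T t (Y i)) (fun i => sgX _ _ _ sT _ _ t0 (XY i)).
have le i : N (T t (Y i)) ^+ 2 <= N (Y i) ^+ 2.
  by rewrite ler_sqr ?nnegrE ?snorm_ge0 //; exact: energy_decreasing.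
have h3 : sum5 (fun i => T t (Y i)) <= sum5 Y by rewrite /sum5 !lerD.
have h4 := ler_wpM2l C10 h3.
rewrite ler_norml in h1; rewrite ler_norml in h2.
case/andP: h1 => _ h1; case/andP: h2 => h2 _.
move: decr h1 h2 h4; rewrite /a [sum5 Y]/sum5 /Y /=; lra.
Qed.
End Multipliers.

(** * Decay on domains of powers of the generator *)

Local Notation DAkk := (DAk D1 E1 D2 E2 A1 A2 B alpha).

Lemma DAk_X k U : DAkk k U -> X U.
Proof. by case: k => [|k] // [/domX]. Qed.

Lemma DAk_le j k U : (j <= k)%N -> DAkk k U -> DAkk j U.
Proof.
elim: j k U => [|j IH] [|k] U //; first by move=> _ /DAk_X.
by rewrite ltnS => jk [dU /(IH _ _ jk)].
Qed.

Lemma DAk_iter i k U : DAkk (i + k) U -> DAkk k (iter i G U).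
Proof. by elim: i U => [|i IH] U //; rewrite addSn iterSr => -[_ /IH]. Qed.

Lemma DAk_T t k U : 0 <= t -> DAkk k U -> DAkk k (T t U).
Proof.
move=> t0; elim: k U => [|k IH] U; first exact: sgX sT _ _ t0.
by move=> [dU kU]; have [dT eT] := T_dom _ _ t0 dU; split => //; rewrite eT; exact: IH.
Qed.

Lemma iter_T t i k U : 0 <= t -> (i <= k)%N -> DAkk k U ->
  iter i G (T t U) = T t (iter i G U).
Proof.
move=> t0; elim: i k U => // i IH [|k] U // ik [dU kU].
by have [_ eT] := T_dom _ _ t0 dU; rewrite !iterSr eT; exact: IH kU.
Qed.

(** Lets [W] approach G^4 U in [lyapunov_decay], by density of the domain. *)
Lemma decay_D4 : exists2 C : R, 0 <= C & forall U, DAkk 4 U -> forall t, 0 <= t ->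
  t * N (T t U) ^+ 2 <= C * \sum_(i < 5) N (iter i G U) ^+ 2.
Proof.
have [J [JD AJ JA Jlin]] := inverse_exists.
have [C1 [C2 [C10 C20 h]]] := lyapunov_decay J JD AJ JA Jlin.
exists (2 * C1) => [|U U4 t t0]; first exact: mulr_ge0.
apply/ler_addgt0Pr => e e0.
(* Dominates the total error d (2 C1 + t C2), obtained after d <= 1 has replaced d^2 by d. *)
pose Q := 2 * C1 + t * C2 + 1.
have Q0 : 0 < Q by rewrite /Q ltr_wpDl // addr_ge0 // mulr_ge0.
pose d := Num.min 1 (e / Q).
have d0 : 0 < d by rewrite lt_min ltr01 divr_gt0.
have d1 : d <= 1 by rewrite ge_min lexx.
have dQ : d * Q <= e by rewrite -ler_pdivlMr // ge_min lexx orbT.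
have X4 : X (iter 4 G U) by exact: DAk_iter (U4 : DAkk (4 + 0) U).
have [W [XW DW UW]] := energy_dense _ hip_ok _ _ _ _ _ _ _ _ _ _ _
  hA1 hA2 hom1 hom2 hA1c hA2c hS1 hS2 halpha _ _ X4 d0.
have hW : N W ^+ 2 <= 2 * N (iter 4 G U) ^+ 2 + 2 * d ^+ 2.
  apply: sqr_leD; first exact: snorm_ge0.
  have := ler_snorm_dist _ _ hb _ _ _ XW X4 (lsub0 _ sX); rewrite !subr0.
  by rewrite (snormBC _ _ hb) //; lra.
have dd : d ^+ 2 <= d by rewrite expr2 ler_piMr // ltW.
have hd : N (iter 4 G U - W) ^+ 2 <= d ^+ 2.
  by rewrite ler_sqr ?nnegrE ?snorm_ge0 // ltW.
apply: le_trans (h U W U4 DW t t0) _.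
rewrite !big_ord_recr big_ord0 /= add0r.
have k1 := ler_wpM2l C10 hW; have tC := mulr_ge0 t0 C20.
have k2 := ler_wpM2l tC (le_trans hd dd).
have k3 := ler_wpM2l C10 dd.
move: k1 k2 k3 dQ; rewrite /Q /=.
have n0 := sqr_ge0 (N U); have n1 := sqr_ge0 (N (G U)).
have n2 := sqr_ge0 (N (G (G U))); have n3 := sqr_ge0 (N (G (G (G U)))).
have := mulr_ge0 C10 n0; have := mulr_ge0 C10 n1; have := mulr_ge0 C10 n2.
have := mulr_ge0 C10 n3; lra.
Qed.

Let sumN k U := \sum_(i < k.+1) N (iter i G U) ^+ 2.

Let sumN_ge k i U : (i <= k)%N -> N (iter i G U) ^+ 2 <= sumN k U.
Proof.
move=> ik; rewrite /sumN (bigD1 (Ordinal (ik : (i < k.+1)%N))) //= lerDl.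
by apply: sumr_ge0 => j _; exact: sqr_ge0.
Qed.

Let sumN_ge0 k U : 0 <= sumN k U.
Proof. by apply: sumr_ge0 => j _; exact: sqr_ge0. Qed.

(** Induction by halving time: [decay_D4] on the second half costs the energies of G^k applied to T
    (t/2) U for k <= 4, and the induction hypothesis on the first half bounds each, as G^k U lies in
    the domain of the power 4 n. *)
Lemma decay_D4n n : exists2 C : R, 0 < C & forall U, DAkk (4 * n) U ->
  forall t, 0 <= t -> t ^+ n * N (T t U) ^+ 2 <=
    C * \sum_(i < (4 * n).+1) N (iter i G U) ^+ 2.
Proof.
elim: n => [|n [C C0 IH]].
  exists 1 => // U XU t t0; rewrite expr0 !mul1r big_ord1 /=.
  by rewrite ler_sqr ?nnegrE ?snorm_ge0 //; exact: energy_decreasing.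
have [C4 C40 h4] := decay_D4.
pose m : R := (4 * n).+1%:R.
have m0 : 0 < m by rewrite ltr0n.
(* The power of 2 comes from t = 2 s, the 5 from the terms of [decay_D4], and [m] counts the terms
   of a sum, each bounded by the whole of [S]. *)
pose C' := 2 ^+ n.+1 * (C4 * (5 * (C * m))).
have C'0 : 0 <= C' by rewrite !mulr_ge0 ?exprn_ge0 // ltW.
exists (C' + 1) => [|U dU t t0]; first by rewrite ltr_wpDl.
pose s := t / 2; have s0 : 0 <= s by rewrite divr_ge0.
set S := \sum_(i < _) _.
have S0 : 0 <= S by exact: sumN_ge0.
have each k : (k < 5)%N -> s ^+ n * N (T s (iter k G U)) ^+ 2 <= C * (m * S).
  move=> k5; have dk : DAkk (4 * n) (iter k G U).
    by apply: DAk_iter; apply: DAk_le dU; rewrite mulnS leq_add2r.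
  apply: le_trans (IH _ dk s s0) _; rewrite ler_pM2l //.
  apply: (@le_trans _ _ (\sum_(i < (4 * n).+1) S)); last first.
    by rewrite sumr_const card_ord /m mulr_natl.
  apply: ler_sum => i _; rewrite -iterD; apply: sumN_ge.
  by rewrite mulnS addnC leq_add // -ltnS.
have dV : DAkk 4 (T s U).
  by apply: DAk_T => //; apply: DAk_le dU; rewrite mulnS leq_addr.
have := h4 _ dV s s0; rewrite -(sg_add _ _ _ sT) //; last exact: DAk_X dU.
have -> : s + s = t by rewrite /s; lra.
move=> h; have sn : 0 <= s ^+ n by exact: exprn_ge0.
have h1 := ler_wpM2l sn h.
have h2 : s ^+ n * \sum_(i < 5) N (iter i G (T s U)) ^+ 2 <= 5 * (C * (m * S)).
  rewrite mulr_sumr; apply: (@le_trans _ _ (\sum_(i < 5) (C * (m * S)))).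
    apply: ler_sum => i _; rewrite (iter_T s i 4 U) ?each //; first by rewrite -ltnS.
    by apply: DAk_le dU; rewrite mulnS leq_addr.
  by rewrite sumr_const card_ord mulr_natl.
have -> : t ^+ n.+1 = 2 ^+ n.+1 * (s ^+ n * s).
  by rewrite -exprSr -exprMn /s mulrC divfK.
apply: (@le_trans _ _ (C' * S)); last by rewrite ler_wpM2r // lerDl.
have -> : C' * S = 2 ^+ n.+1 * (C4 * (5 * (C * (m * S)))) by rewrite /C'; ring.
rewrite -mulrA; apply: ler_wpM2l; first exact: exprn_ge0.
rewrite -mulrA; apply: le_trans h1 _; rewrite mulrCA; exact: ler_wpM2l.
Qed.

(** * The K-functional *)

Local Notation gnorm k := (graph_norm ip S1 S2 A1 A2 B alpha k).
Local Notation Kf k := (Kfun X (hnorm ip S1 S2 alpha) (DAkk k) (gnorm k)).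

(** Provides the splitting x = x + 0, so that the infimum in [Kfun] is over a nonempty set. *)
Lemma DAk0 k : DAkk k 0.
Proof.
have X0 := lsub0 _ sX.
have /(gen_atP _ _ X0 X0)[d0 g0] : gen_at b T 0 0.
  apply/cvg_right0P => e e0; exists 1 => // h h0 _.
  rewrite (lin_on0 _ _ hb _ (sg_lin _ _ _ sT h (ltW h0))) !subrr scaler0 subrr.
  by rewrite (snorm0 _ _ hb) subrr normr0.
by elim: k => [|k IH]; [exact: X0|split => //; rewrite g0].
Qed.

Lemma Kfun_ge k s x l : X x ->
  (forall a y, X a -> DAkk k y -> x = a + y -> l <= N a + s * gnorm k y) -> l <= Kf k s x.
Proof.
move=> Xx h; apply: lb_le_inf.
  exists (N x + s * gnorm k 0), x, 0; split => //; split; first exact: DAk0.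
  by split => //; rewrite st_addE addr0.
by move=> _ [a [y [Xa [dy [xay ->]]]]]; exact: h.
Qed.

Lemma Kfun_le k s a y : 0 <= s -> X a -> DAkk k y ->
  Kf k s (a + y) <= N a + s * gnorm k y.
Proof.
move=> s0 Xa dy; apply: ge_inf; last by exists a, y.
exists 0 => _ [a' [y' [_ [_ [_ ->]]]]].
by rewrite addr_ge0 ?mulr_ge0 ?snorm_ge0 ?sqrtr_ge0.
Qed.

Lemma Kfun_ge0 k s x : 0 <= s -> X x -> 0 <= Kf k s x.
Proof.
move=> s0 Xx; apply: Kfun_ge => // a y _ _ _.
by rewrite addr_ge0 ?mulr_ge0 ?snorm_ge0 ?sqrtr_ge0.
Qed.

Lemma Kfun_mono k s t x : 0 <= s -> s <= t -> X x -> Kf k s x <= Kf k t x.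
Proof.
move=> s0 st Xx; apply: Kfun_ge => // a y Xa dy ->.
apply: le_trans (Kfun_le _ _ _ _ s0 Xa dy) _; rewrite lerD2l.
by rewrite ler_wpM2r ?sqrtr_ge0.
Qed.

(** [T t] contracts the component in [X], and [decay_D4n] bounds the regular one; the weight is the
    square root of its constant. *)
Lemma decay_Kfun n : exists2 C : R, 0 < C & forall t x, 0 < t -> X x ->
  N (T t x) <= Kf (4 * n) (Num.sqrt (C / t ^+ n)) x.
Proof.
have [C C0 hC] := decay_D4n n; exists C => // t x t0 Xx.
apply: Kfun_ge => // a y Xa dy ->.
have Xy := DAk_X _ _ dy; have t0' := ltW t0.
rewrite (lin_onD _ _ (sg_lin _ _ _ sT t t0')) //.
apply: le_trans (ler_snormD _ _ hb _ _ _ _) _.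
- exact: sgX sT _ _ t0' Xa.
- exact: sgX sT _ _ t0' Xy.
apply: lerD; first exact: energy_decreasing.
have tn : 0 < t ^+ n by exact: exprn_gt0.
have Ct : 0 <= C / t ^+ n by rewrite divr_ge0 // ltW.
rewrite /graph_norm -sqrtrM // -(ger0_norm (snorm_ge0 b (T t y))) -sqrtr_sqr.
rewrite ler_wsqrtr // mulrAC ler_pdivlMr // mulrC; exact: hC.
Qed.
End Decay.

Import HBNNSimple.

(** * Interpolation *)

(** The integral is a supremum over simple functions below [f], and [k] times the indicator of [A]
    is one of them. The bound thus applies to the K-functional without a study of its
    measurability. *)
Lemma ge0_integral_lower_bound (d : measure_display) (T : measurableType d) (R : realType)
    (mu : {measure set T -> \bar R}) (D A : set T) (f : T -> \bar R) (k : R) :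
  measurable A -> A `<=` D -> (forall x, D x -> (0 <= f x)%E) -> 0 <= k ->
  (forall x, A x -> (k%:E <= f x)%E) ->
  (k%:E * mu A <= \int[mu]_(x in D) f x)%E.
Proof.
move=> mA AD f0 k0 kf; rewrite integral_mkcond ge0_integralTE; last first.
  by move=> x; exact: erestrict_ge0.
pose h := scale_nnsfun (indic_nnsfun R mA) k0.
have -> : (k%:E * mu A)%E = sintegral mu h.
  have := sintegralrM mu k (indic_nnsfun R mA); rewrite [in RHS]sintegral_indic => <-.
  exact: eq_sintegral.
apply: ereal_sup_ubound; exists h => //= x.
have [Ax|nAx] := pselect (A x).
  rewrite [measurable_realfun.mindic _ _ _]indicE mem_set // mulr1 patchE mem_set; last exact: AD.
  exact: kf.
by rewrite [measurable_realfun.mindic _ _ _]indicE memNset // mulr0; exact: erestrict_ge0.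
Qed.

(* On [[s, 2 s]] the integrand is at least its value with [t] replaced by [2 s] in the
   weight and by [s] in [K]. *)
Lemma interp_integral_lower_bound (R : realType) (K : R -> R) (theta s : R) :
  0 < theta -> 0 < s -> 0 <= K s -> (forall t, s <= t -> K s <= K t) ->
  ((K s ^+ 2)%:E <= (2 * (4 * s ^+ 2) `^ theta)%:E *
     \int[@lebesgue_measure R]_(t in `]0%R, +oo[)
     ((t `^ (- theta - 2^-1) * K t) ^+ 2)%:E)%E.
Proof.
move=> th0 s0 Ks mono.
pose q : R := 2 * s; have q0 : 0 < q by rewrite mulr_gt0.
pose w := q `^ (- theta - 2^-1).
have w0 : 0 < w by exact: powR_gt0.
have := @ge0_integral_lower_bound _ _ R (@lebesgue_measure R) `]0%R, +oo[ `[s, q]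
  (fun t => ((t `^ (- theta - 2^-1) * K t) ^+ 2)%:E) ((w * K s) ^+ 2).
move=> /(_ (measurable_itv _)) /=.
have -> : lebesgue_measure `[s, q]%classic = s%:E.
  rewrite lebesgue_measure_itv /= lte_fin ifT; last by rewrite /q; lra.
  by rewrite -EFinB /q; congr EFin; lra.
move=> h; apply: le_trans (lee_wpmul2l _ (h _ _ _ _)).
- rewrite -!EFinM lee_fin.
  (* With q = 2 s the factors q^(2 theta), q^(- 2 theta - 1) and q multiply to 1. *)
  have -> : 2 * (4 * s ^+ 2) `^ theta * ((w * K s) ^+ 2 * s) = K s ^+ 2; last by [].
  have -> : 4 * s ^+ 2 = q `^ 2 by rewrite powR_mulrn ?ltW // /q; ring.
  have -> : (w * K s) ^+ 2 = w ^+ 2 * K s ^+ 2 by rewrite exprMn.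
  rewrite -powR_mulrn ?ltW // /w -!powRrM.
  have -> : (- theta - 2^-1) * 2 = - (2 * theta) - 1 by field.
  have -> : q `^ (- (2 * theta) - 1) = (q `^ (2 * theta))^-1 * q^-1.
    by rewrite powRD ?(gt_eqF q0) ?implybT // !powRN powRr1 // ltW.
  have := powR_gt0 (2 * theta) q0; move: (q `^ (2 * theta)) => z z0.
  by rewrite /q; field; rewrite !gt_eqF.
- by rewrite lee_fin mulr_ge0 // powR_ge0.
- by move=> x /=; rewrite !in_itv /= => /andP[sx _]; rewrite andbT (lt_le_trans s0).
- by move=> x _; rewrite lee_fin sqr_ge0.
- exact: sqr_ge0.
- move=> x /=; rewrite in_itv /= => /andP[sx xq].
  have x0 : 0 < x by exact: lt_le_trans sx.
  have Kx := mono _ sx.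
  rewrite lee_fin ler_sqr ?nnegrE ?mulr_ge0 ?powR_ge0 //; last exact: le_trans Kx.
  apply: ler_pM => //; first exact: ltW.
  rewrite /w -opprD !powRN lef_pV2 ?posrE ?powR_gt0 //.
  by apply: ge0_ler_powR => //; rewrite ?nnegrE; lra.
Qed.

Theorem theorem4p1 (R : realType) (H : completeNormedModType R)
  (ip : H -> H -> R) (hip_ok : is_inner ip)
  (D1 : set H) (A1 : H -> H) (D2 : set H) (A2 : H -> H)
  (E1 : set H) (S1 : H -> H) (E2 : set H) (S2 : H -> H)
  (B : H -> H) (omega1 omega2 beta alpha : R)
  (hA1 : self_adjoint ip D1 A1) (hA2 : self_adjoint ip D2 A2)
  (hom1 : 0 < omega1) (hom2 : 0 < omega2)
  (hA1c : forall u, D1 u -> ip (A1 u) u >= omega1 * `|u| ^+ 2)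
  (hA2c : forall u, D2 u -> ip (A2 u) u >= omega2 * `|u| ^+ 2)
  (hS1 : is_sqrt_op ip D1 A1 E1 S1) (hS2 : is_sqrt_op ip D2 A2 E2 S2)
  (hB : bounded_sa ip B) (hbeta : 0 < beta)
  (hBc : forall u, ip (B u) u >= beta * `|u| ^+ 2)
  (halpha : 0 < `|alpha| < Num.sqrt (omega1 * omega2))
  (T : R -> St H -> St H)
  (hT : generates (inHH E1 E2) (hnorm ip S1 S2 alpha) (DAA D1 E1 D2 E2)
          (AA A1 A2 B alpha) T)
  (hD21 : D2 `<=` E1)
  (c : R) (hc : 0 < c) (hcc : forall u, D2 u -> `|S1 u| <= c * `|A2 u|)
  (n : nat) (hn : (1 <= n)%N) (theta : R) (htheta : 0 < theta < 1) :
  exists cnt : R, 0 < cnt /\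
    forall U0 : St H,
      in_interp (inHH E1 E2) (hnorm ip S1 S2 alpha)
        (DAk D1 E1 D2 E2 A1 A2 B alpha (4 * n))
        (graph_norm ip S1 S2 A1 A2 B alpha (4 * n)) theta U0 ->
      forall t : R, 0 < t ->
        (((hnorm ip S1 S2 alpha (T t U0)) ^+ 2)%:E <=
        (cnt / t `^ (n%:R * theta))%:E *
          interp_norm2 (inHH E1 E2) (hnorm ip S1 S2 alpha)
            (DAk D1 E1 D2 E2 A1 A2 B alpha (4 * n))
            (graph_norm ip S1 S2 A1 A2 B alpha (4 * n)) theta U0)%E.
Proof.
have [C C0 hC] := decay_Kfun _ hip_ok _ _ _ _ _ _ _ _ _ _ _ _ _ hA1 hA2 hom1 hom2 hA1c hA2c
  hS1 hS2 hB hbeta hBc halpha _ hT hD21 _ hc hcc n.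
case/andP: htheta => th0 _.
(* This is 2 (4 s^2)^theta at s^2 = C / t^n, with the power of t taken out. *)
exists (2 * (4 * C) `^ theta); split.
  by rewrite mulr_gt0 // powR_gt0 // mulr_gt0.
move=> U0 [XU _] t t0.
have tn : 0 < t ^+ n by exact: exprn_gt0.
have Ct : 0 < C / t ^+ n by exact: divr_gt0.
set s := Num.sqrt (C / t ^+ n).
have s0 : 0 < s by rewrite sqrtr_gt0.
pose K r := Kfun (inHH E1 E2) (hnorm ip S1 S2 alpha)
  (DAk D1 E1 D2 E2 A1 A2 B alpha (4 * n)) (graph_norm ip S1 S2 A1 A2 B alpha (4 * n)) r U0.
have K0 r : 0 <= r -> 0 <= K r.
  by move=> r0; apply: (Kfun_ge0 _ hip_ok _ _ _ _ _ _ _ _ _ _ _ _ hA1 hA2 hom1 hom2 hA1c hA2c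
    hS1 hS2 halpha _ hT).
have Kmono r : s <= r -> K s <= K r.
  by move=> sr; apply: (Kfun_mono _ hip_ok _ _ _ _ _ _ _ _ _ _ _ _ hA1 hA2 hom1 hom2 hA1c hA2c
    hS1 hS2 halpha _ hT) => //; exact: ltW.
have -> : 2 * (4 * C) `^ theta / t `^ (n%:R * theta) = 2 * (4 * s ^+ 2) `^ theta.
  have tni : (t ^+ n)^-1 `^ theta = (t `^ (n%:R * theta))^-1.
    by rewrite powRrM (powR_mulrn _ (ltW t0)) -(powR_inv1 (ltW tn)) -powRrM mulN1r powRN.
  rewrite sqr_sqrtr ?(ltW Ct) // [4 * (C / _)]mulrA [in RHS]powRM ?tni ?mulrA //.
    by rewrite mulr_ge0 // ltW.
  by rewrite invr_ge0 ltW.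
apply: le_trans (interp_integral_lower_bound _ K theta s th0 s0 (K0 _ (ltW s0)) Kmono).
rewrite lee_fin ler_sqr ?nnegrE ?sqrtr_ge0 //; first exact: hC.
exact: K0 (ltW s0).
Qed.
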